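(* Let $(R,\mathfrak m)$ be a universally catenary (Noetherian) local ring, and let $G=\bigoplus_{i\ge0}\mathfrak m^i/\mathfrak m^{i+1}$ be its associated graded ring. Then $\operatorname{sdim}(G)\ge\operatorname{sdim}(R)$. Moreover, $\operatorname{sdim}(G)=\operatorname{sdim}(R)$ if $G$ satisfies Serre's condition $(S_1)$.
   Context: For a Noetherian ring $A$, the subdimension is $\operatorname{sdim}(A)=\min\{\dim(A/\mathfrak p)\mid \mathfrak p\in\operatorname{Min}(A)\}$, where $\operatorname{Min}(A)$ is the set of minimal primes of $A$. A ring $A$ is universally catenary if every finitely generated $A$-algebra is catenary. A Noetherian ring satisfies $(S_1)$ if it has no embedded associated primes. *)

(* Defs.v *)
From HB Require Import structures.
From mathcomp Require Import all_boot all_order all_algebra.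
From mathcomp Require Import boolp classical_sets constructive_ereal.

Set Implicit Arguments.
Unset Strict Implicit.
Unset Printing Implicit Defensive.

Import Order.TTheory GRing.Theory Num.Theory.

Local Open Scope ring_scope.
Local Open Scope classical_set_scope.
Local Open Scope quotient_scope.

(* Ideals are MathComp's [idealr] (proper ideals) and [prime_idealr]; their    *)
(* membership predicates are boolean, which is no restriction classically.     *)

Section Ideals.
Variable A : comNzRingType.
Implicit Types (p q : prime_idealr A) (M : idealr A).

Definition noetherian : Prop :=
  forall I : idealr A, exists s : seq A, forall x,
    x \in I <-> exists c : nat -> A, x = \sum_(i < size s) c i * s`_i.

Definition maximal_ideal M : Prop :=
  forall I : idealr A, {subset M <= I} -> {subset I <= M}.

Definition local_ring M : Prop :=
  maximal_ideal M /\ forall M' : idealr A, maximal_ideal M' -> M' =i M.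

Definition strict_sub p q : Prop := {subset p <= q} /\ ~ {subset q <= p}.

Definition minimal_prime : set (prime_idealr A) :=
  [set p | forall q, {subset q <= p} -> {subset p <= q}].

(* c 0 < c 1 < ... < c n; the values of c beyond n are irrelevant. *)
Definition prime_chain (n : nat) (c : nat -> prime_idealr A) : Prop :=
  forall i, (i < n)%N -> strict_sub (c i) (c i.+1).

Definition prime_chain_between p q (n : nat) (c : nat -> prime_idealr A) : Prop :=
  [/\ prime_chain n c, c 0%N =i p & c n =i q].

Definition maximal_chain_between p q (n : nat) (c : nat -> prime_idealr A) : Prop :=
  prime_chain_between p q n c /\
  forall i, (i < n)%N ->
    ~ exists r : prime_idealr A, strict_sub (c i) r /\ strict_sub r (c i.+1).

Definition catenary : Prop :=
  forall p q, {subset p <= q} ->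
    (exists N : nat, forall n c, prime_chain_between p q n c -> (n <= N)%N) /\
    (forall n c n' c', maximal_chain_between p q n c ->
       maximal_chain_between p q n' c' -> n = n').

(* Supremum of the lengths of chains of primes, +oo if they are unbounded. *)
Definition krull_dim : \bar int :=
  supremum -oo%E
    [set (n%:Z)%:E | n in [set n | exists c, prime_chain n c]].

Definition associated_prime p : Prop :=
  exists x : A, forall a, a \in p <-> a * x = 0.

Definition embedded_prime p : Prop :=
  associated_prime p /\ exists q, associated_prime q /\ strict_sub q p.

Definition serre_S1 : Prop := ~ exists p, embedded_prime p.

End Ideals.

Definition minimum (S : set (\bar int)) : \bar int :=
  xget +oo%E (S `&` lbound S).

Definition sdim (A : comNzRingType) : \bar int :=
  minimum [set krull_dim {ideal_quot (p : idealr A)}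
          | p in @minimal_prime A].

Definition fg_algebra (R : comNzRingType) (B : comAlgType R) : Prop :=
  exists s : seq B, forall S : {pred B},
    subalg_closed S -> {subset s <= S} -> forall b, b \in S.

(* [comAlgType] leaves out only the zero algebra, which has no primes and is   *)
(* thus trivially catenary.                                                    *)
Definition universally_catenary (R : comNzRingType) : Prop :=
  forall B : comAlgType R, fg_algebra B -> catenary B.

Section IdealPowers.
Variable R : comNzRingType.

Definition ideal_mul (I J : set R) : set R :=
  [set x | exists s : seq (R * R),
     (forall ab, ab \in s -> I ab.1 /\ J ab.2) /\ x = \sum_(ab <- s) ab.1 * ab.2].

Variable I : idealr R.

Definition ideal_pow (n : nat) : pred R :=
  fun x => `[< iter n (ideal_mul [set a | a \in I]) setT x >].

Lemma ideal_powS n x : reflect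
  (exists s : seq (R * R),
     (forall ab, ab \in s -> ab.1 \in I /\ ab.2 \in ideal_pow n) /\
     x = \sum_(ab <- s) ab.1 * ab.2)
  (x \in ideal_pow n.+1).
Proof.
apply: (iffP (asboolP _)) => -[s [sP ->]]; exists s; split=> // ab /sP[? H].
  by split=> //; apply/asboolP.
by split=> //; apply/asboolP.
Qed.

Lemma ideal_pow0E x : x \in ideal_pow 0.
Proof. by apply/asboolP. Qed.

Lemma ideal_powD n : {in ideal_pow n &, forall x y, x + y \in ideal_pow n}.
Proof.
case: n => [|n] x y; first by move=> _ _; exact: ideal_pow0E.
move=> /ideal_powS[s [sP ->]] /ideal_powS[t [tP ->]]; apply/ideal_powS.
exists (s ++ t); split; last by rewrite big_cat.
by move=> ab; rewrite mem_cat => /orP[/sP|/tP].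
Qed.

Lemma ideal_powM n a x : x \in ideal_pow n -> a * x \in ideal_pow n.
Proof.
case: n => [|n]; first by move=> _; exact: ideal_pow0E.
move=> /ideal_powS[s [sP ->]]; apply/ideal_powS.
exists [seq (a * ab.1, ab.2) | ab <- s]; split.
  by move=> _ /mapP[ab /sP[? ?] ->] /=; split=> //; apply: idealMr.
by rewrite big_map mulr_sumr; apply: eq_bigr => ab _; rewrite mulrA.
Qed.

Lemma ideal_pow_0 n : 0 \in ideal_pow n.
Proof.
by case: n => [|n]; [exact: ideal_pow0E | apply/ideal_powS; exists [::]; rewrite big_nil].
Qed.

Lemma ideal_pow_zmod_closed n : zmod_closed (ideal_pow n).
Proof.
split=> [|x y xI yI]; first exact: ideal_pow_0.
by apply: ideal_powD => //; rewrite -mulN1r; apply: ideal_powM.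
Qed.

HB.instance Definition _ n :=
  GRing.isZmodClosed.Build R (ideal_pow n) (ideal_pow_zmod_closed n).

Lemma ideal_pow_mul a b x y :
  x \in ideal_pow a -> y \in ideal_pow b -> x * y \in ideal_pow (a + b).
Proof.
elim: a x => [|a IH] x; first by move=> _; exact: ideal_powM.
move=> /ideal_powS[s [sP ->]] yI; apply/ideal_powS.
exists [seq (ab.1, ab.2 * y) | ab <- s]; split.
  by move=> _ /mapP[ab /sP[? ?] ->] /=; split=> //; apply: IH.
by rewrite big_map mulr_suml; apply: eq_bigr => ab _; rewrite mulrA.
Qed.

Lemma ideal_pow_mul_eq a b n x y : (a + b)%N = n ->
  x \in ideal_pow a -> y \in ideal_pow b -> x * y \in ideal_pow n.
Proof. by move=> <-; exact: ideal_pow_mul. Qed.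

Lemma ideal_pow1 x : x \in ideal_pow 1 -> x \in I.
Proof.
move=> /ideal_powS[s [sP ->]].
rewrite big_seq; apply: rpred_sum => ab /sP[? _].
by rewrite mulrC; apply: idealMr.
Qed.

(* The component I^n / I^(n+1): the subgroup I^n of R, quotiented by I^(n+1). *)
Definition pow_sub (n : nat) : Type := {x : R | ideal_pow n x}.
HB.instance Definition _ n := SubChoice.on (pow_sub n).
HB.instance Definition _ n :=
  [SubChoice_isSubZmodule of pow_sub n by <:].

Definition pow_next (n : nat) : pred (pow_sub n) :=
  fun x => val x \in ideal_pow n.+1.

Lemma pow_next_zmod_closed n : zmod_closed (@pow_next n).
Proof.
split=> [|x y xI yI]; first by rewrite unfold_in /pow_next raddf0 rpred0.
by rewrite unfold_in /pow_next raddfB rpredB.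
Qed.

HB.instance Definition _ n :=
  GRing.isZmodClosed.Build (pow_sub n) (@pow_next n) (@pow_next_zmod_closed n).

Local Notation gr_comp n :=
  (Quotient.quot (GRing.ZmodClosed.clone _ (@pow_next n) _)).

(* The direct sum of the I^n / I^(n+1): finitely supported families. *)
Record assoc_graded : Type := AssocGraded {
  gr_fun :> forall n, gr_comp n;
  gr_finite : exists N, forall n, (N <= n)%N -> gr_fun n = 0
}.

HB.instance Definition _ := gen_eqMixin assoc_graded.
HB.instance Definition _ := gen_choiceMixin assoc_graded.

Implicit Types f g h : assoc_graded.

Lemma gr_eq f g : (forall n, f n = g n) -> f = g.
Proof.
case: f g => [f fN] [g gN] /= fg.
have {}fg : f = g by apply: functional_extensionality_dep.
by case: _ / fg gN => gN; congr AssocGraded; exact: Prop_irrelevance.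
Qed.

Definition gr_lift f (n : nat) : R := val (repr (f n)).

Lemma gr_lift_mem f n : gr_lift f n \in ideal_pow n.
Proof. exact: (valP (repr (f n))). Qed.

Definition pow_elt n (x : R) (xI : x \in ideal_pow n) : pow_sub n := exist _ x xI.

Definition gr_class n (x : R) (xI : x \in ideal_pow n) : gr_comp n :=
  \pi_(gr_comp n) (pow_elt xI).

Lemma gr_class_eq n x y (xI : x \in ideal_pow n) (yI : y \in ideal_pow n) :
  (gr_class xI == gr_class yI) = (x - y \in ideal_pow n.+1).
Proof. by rewrite /gr_class -[LHS]Quotient.idealrBE unfold_in /pow_next raddfB. Qed.

Lemma gr_classK f n : gr_class (gr_lift_mem f n) = f n.
Proof.
by rewrite /gr_class -[RHS]reprK; congr (\pi _); exact: val_inj.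
Qed.

Lemma gr_class_lift f n x (xI : x \in ideal_pow n) :
  f n = gr_class xI -> gr_lift f n - x \in ideal_pow n.+1.
Proof. by move=> E; rewrite -(gr_class_eq (gr_lift_mem f n) xI) gr_classK E. Qed.

Lemma gr_class0 n x (xI : x \in ideal_pow n) :
  (gr_class xI == 0) = (x \in ideal_pow n.+1).
Proof.
have -> : 0 = gr_class (ideal_pow_0 n).
  rewrite /gr_class -[LHS](raddf0 \pi_(gr_comp n)); congr (\pi _).
  exact: val_inj.
by rewrite gr_class_eq subr0.
Qed.

Lemma gr_lift0 f n : f n = 0 -> gr_lift f n \in ideal_pow n.+1.
Proof. by move=> f0; rewrite -(gr_class0 (gr_lift_mem f n)) gr_classK f0. Qed.

Fact gr_zero_finite : exists N, forall n, (N <= n)%N -> (0 : gr_comp n) = 0.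
Proof. by exists 0%N. Qed.
Definition gr_zero : assoc_graded := AssocGraded gr_zero_finite.

Fact gr_opp_finite f : exists N, forall n, (N <= n)%N -> - f n = 0.
Proof. by case: (gr_finite f) => N fN; exists N => n /fN ->; rewrite oppr0. Qed.
Definition gr_opp f : assoc_graded := AssocGraded (gr_opp_finite f).

Fact gr_add_finite f g : exists N, forall n, (N <= n)%N -> f n + g n = 0.
Proof.
case: (gr_finite f) (gr_finite g) => N fN [M gM]; exists (maxn N M) => n.
by rewrite geq_max => /andP[/fN-> /gM->]; rewrite addr0.
Qed.
Definition gr_add f g : assoc_graded := AssocGraded (gr_add_finite f g).

Fact gr_addA : associative gr_add.
Proof. by move=> f g h; apply: gr_eq => n; exact: addrA. Qed.
Fact gr_addC : commutative gr_add.
Proof. by move=> f g; apply: gr_eq => n; exact: addrC. Qed.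
Fact gr_add0 : left_id gr_zero gr_add.
Proof. by move=> f; apply: gr_eq => n; exact: add0r. Qed.
Fact gr_addN : left_inverse gr_zero gr_opp gr_add.
Proof. by move=> f; apply: gr_eq => n; exact: addNr. Qed.

HB.instance Definition _ :=
  GRing.isZmodule.Build assoc_graded gr_addA gr_addC gr_add0 gr_addN.

Definition conv (u v : nat -> R) (n : nat) : R := \sum_(i < n.+1) u i * v (n - i)%N.

Lemma conv_mem u v (uI : forall n, u n \in ideal_pow n)
  (vI : forall n, v n \in ideal_pow n) n : conv u v n \in ideal_pow n.
Proof.
apply: rpred_sum => i _; have ein : (i + (n - i) = n)%N.
  by rewrite subnKC // -ltnS.
exact: ideal_pow_mul_eq ein (uI i) (vI _).
Qed.

Lemma conv_poly u v N n : (n <= N)%N ->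
  conv u v n = ((\poly_(i < N.+1) u i) * (\poly_(i < N.+1) v i))`_n.
Proof.
move=> nN; rewrite coefM; apply: eq_bigr => i _; rewrite !coef_poly.
have iN : (i <= N)%N by apply: leq_trans nN; rewrite -ltnS.
by rewrite !ltnS iN (leq_trans (leq_subr _ _) nN).
Qed.

Lemma convA u v w : conv u (conv v w) =1 conv (conv u v) w.
Proof.
move=> n; pose P (x : nat -> R) := \poly_(i < n.+1) x i.
transitivity ((P u * (P v * P w))`_n); last rewrite mulrA; rewrite coefM.
  apply: eq_bigr => i _; have iN : (i <= n)%N by rewrite -ltnS.
  by rewrite coef_poly ltn_ord (conv_poly _ _ (leq_subr i n)).
apply: eq_bigr => i _; have iN : (i <= n)%N by rewrite -ltnS.
by rewrite coef_poly ltnS leq_subr (conv_poly _ _ iN).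
Qed.

Lemma convC u v : conv u v =1 conv v u.
Proof. by move=> n; rewrite !(conv_poly _ _ (leqnn n)) mulrC. Qed.

(* (f * g)_n is the class modulo I^(n+1) of the sum over i + j = n of the       *)
(* products of representatives of f_i and g_j.                                 *)
Definition gr_mul_fun f g (n : nat) : gr_comp n :=
  gr_class (conv_mem (gr_lift_mem f) (gr_lift_mem g) n).

Fact gr_mul_finite f g : exists N, forall n, (N <= n)%N -> gr_mul_fun f g n = 0.
Proof.
case: (gr_finite f) (gr_finite g) => N fN [M gM]; exists (N + M)%N => n NMn.
apply/eqP; rewrite gr_class0; apply: rpred_sum => i _.
have ein : (i + (n - i) = n)%N by rewrite subnKC // -ltnS.
have [Ni|iN] := leqP N i.
  apply: (@ideal_pow_mul_eq i.+1 (n - i)); first by rewrite addSn ein.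
    exact/gr_lift0/fN.
  exact: gr_lift_mem.
apply: (@ideal_pow_mul_eq i (n - i).+1); [by rewrite addnS ein|exact: gr_lift_mem|].
apply/gr_lift0/gM; rewrite leq_subRL; last by rewrite -ltnS.
by apply: leq_trans NMn; rewrite leq_add2r ltnW.
Qed.

Definition gr_mul f g : assoc_graded := AssocGraded (gr_mul_finite f g).

Definition gr_one_lift (n : nat) : R := (n == 0%N)%:R.

Lemma gr_one_mem n : gr_one_lift n \in ideal_pow n.
Proof. by case: n => [|n]; [exact: ideal_pow0E | exact: ideal_pow_0]. Qed.

Fact gr_one_finite : exists N, forall n, (N <= n)%N -> gr_class (gr_one_mem n) = 0.
Proof. by exists 1%N => -[|n] // _; apply/eqP; rewrite gr_class0 rpred0. Qed.

Definition gr_one : assoc_graded := AssocGraded gr_one_finite.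

Lemma conv_congr u u' v v' n :
  (forall k, v k \in ideal_pow k) -> (forall k, u' k \in ideal_pow k) ->
  (forall k, u k - u' k \in ideal_pow k.+1) ->
  (forall k, v k - v' k \in ideal_pow k.+1) ->
  conv u v n - conv u' v' n \in ideal_pow n.+1.
Proof.
move=> vI u'I uu' vv'; rewrite -sumrB; apply: rpred_sum => i _.
have ein : (i + (n - i) = n)%N by rewrite subnKC // -ltnS.
rewrite -[u i * _](subrK (u' i * v (n - i)%N)) -mulrBl -addrA -mulrBr.
apply: rpredD.
  by apply: (@ideal_pow_mul_eq i.+1 (n - i)) => //; rewrite addSn ein.
by apply: (@ideal_pow_mul_eq i (n - i).+1) => //; rewrite addnS ein.
Qed.

Lemma gr_lift_mul f g n :
  gr_lift (gr_mul f g) n - conv (gr_lift f) (gr_lift g) n \in ideal_pow n.+1.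
Proof. exact: (@gr_class_lift (gr_mul f g) n _ _ erefl). Qed.

Lemma gr_lift_add f g n :
  gr_lift (f + g) n - (gr_lift f n + gr_lift g n) \in ideal_pow n.+1.
Proof.
apply: (@gr_class_lift _ n _ (ideal_powD (gr_lift_mem f n) (gr_lift_mem g n))).
rewrite -[LHS]/(f n + g n) -[f n]gr_classK -[g n]gr_classK /gr_class -[LHS]raddfD.
by congr (\pi _); apply: val_inj; rewrite raddfD.
Qed.

Lemma gr_lift_one n : gr_lift gr_one n - gr_one_lift n \in ideal_pow n.+1.
Proof. exact: (@gr_class_lift gr_one n _ _ erefl). Qed.

Lemma gr_eqP f g :
  (forall n, gr_lift f n - gr_lift g n \in ideal_pow n.+1) -> f = g.
Proof.
move=> fg; apply: gr_eq => n; rewrite -[f n]gr_classK -[g n]gr_classK.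
by apply/eqP; rewrite gr_class_eq.
Qed.

Let subxx n (x : R) : x - x \in ideal_pow n.
Proof. by rewrite subrr rpred0. Qed.

Let sub_sym n (x y : R) : x - y \in ideal_pow n -> y - x \in ideal_pow n.
Proof. by rewrite -[y - x]opprB rpredN. Qed.

Let sub_trans n (y x z : R) :
  x - y \in ideal_pow n -> y - z \in ideal_pow n -> x - z \in ideal_pow n.
Proof. by move=> xy yz; rewrite -(subrK y x) -addrA rpredD. Qed.

Fact gr_mulA : associative gr_mul.
Proof.
move=> f g h; apply: gr_eqP => n.
apply: sub_trans (gr_lift_mul _ _ _) _; apply: sub_sym.
apply: sub_trans (gr_lift_mul _ _ _) _.
apply: (sub_trans (y := conv (conv (gr_lift f) (gr_lift g)) (gr_lift h) n)).
  apply: conv_congr => // k; do ?exact: gr_lift_mem; last exact: gr_lift_mul.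
  by apply: conv_mem => ?; exact: gr_lift_mem.
rewrite -convA; apply: conv_congr => // k; do ?exact: gr_lift_mem.
  by apply: conv_mem => ?; exact: gr_lift_mem.
by apply: sub_sym; exact: gr_lift_mul.
Qed.

Fact gr_mulC : commutative gr_mul.
Proof.
move=> f g; apply: gr_eqP => n.
apply: sub_trans (gr_lift_mul _ _ _) _; apply: sub_sym.
by rewrite convC; exact: gr_lift_mul.
Qed.

Fact gr_mul1 : left_id gr_one gr_mul.
Proof.
move=> f; apply: gr_eqP => n.
apply: sub_trans (gr_lift_mul _ _ _) _.
have <- : conv gr_one_lift (gr_lift f) n = gr_lift f n.
  rewrite /conv big_ord_recl /= big1 ?addr0 ?mul1r ?subn0 // => i _.
  by rewrite mul0r.
by apply: conv_congr => // k; [exact: gr_lift_mem|exact: gr_one_mem|exact: gr_lift_one].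
Qed.

Fact gr_mulDl : left_distributive gr_mul +%R.
Proof.
move=> f g h; apply: gr_eqP => n.
apply: sub_trans (gr_lift_mul _ _ _) _; apply: sub_sym.
apply: sub_trans (gr_lift_add _ _ _) _; apply: sub_sym.
apply: (sub_trans (y := conv (fun n => gr_lift f n + gr_lift g n) (gr_lift h) n)).
  apply: conv_congr => // k; first exact: gr_lift_mem.
    by apply: rpredD; exact: gr_lift_mem.
  exact: gr_lift_add.
have -> : conv (fun n => gr_lift f n + gr_lift g n) (gr_lift h) n
  = conv (gr_lift f) (gr_lift h) n + conv (gr_lift g) (gr_lift h) n.
  by rewrite -big_split; apply: eq_bigr => i _; rewrite mulrDl.
by rewrite opprD addrACA; apply: rpredD; apply: sub_sym; exact: gr_lift_mul.
Qed.

Fact gr_one_neq0 : gr_one != 0.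
Proof.
apply/negP => /eqP E; have : gr_one 0%N == 0 by rewrite E.
by rewrite gr_class0 => /ideal_pow1; rewrite idealr1.
Qed.

HB.instance Definition _ := GRing.Zmodule_isComNzRing.Build assoc_graded
  gr_mulA gr_mulC gr_mul1 gr_mulDl gr_one_neq0.

End IdealPowers.

(* Main.v *)
Require Import Defs.
From HB Require Import structures.
From mathcomp Require Import all_boot all_order all_algebra.
From mathcomp Require Import boolp classical_sets constructive_ereal.
From mathcomp Require Import zify.
From Stdlib Require Ring_theory Ring_polynom InitialRing.

Set Implicit Arguments.
Unset Strict Implicit.
Unset Printing Implicit Defensive.

Import Order.TTheory GRing.Theory Num.Theory.

Local Open Scope ring_scope.
Local Open Scope classical_set_scope.
Local Open Scope quotient_scope.

(** Write S = R[m t, u] with u = 1/t for the extended Rees ring, so that u is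
    a nonzerodivisor of S and S/uS is the associated graded ring G. Minimal
    primes of G are the primes Q of S that are minimal over u. A prime p of R
    extends to the prime P(p) of S consisting of the elements whose
    coefficients lie in p (rees_ext); it is the least prime of S over p that
    does not contain u. Let M be the maximal ideal of S generated by u and
    the elements of nonzero degree and of m (graded_maximal).

    Lower bound (graded_chain_lower_bound). If Q is minimal over u, then Q
    contains P(p) for some minimal prime p of R, and by Krull's principal
    ideal theorem (krull_principal_ideal) no prime lies strictly between
    P(p) and Q. A minimal prime of G consists of zero divisors, while an
    element of S with unit constant term is regular modulo u; hence Q lies in
    M (min_over_graded_maximal). A chain of primes of length n above p in R
    extends to a chain from P(p) into P(m), which is strictly smaller than M;
    so there is a chain of length n + 1 from P(p) to M. As S is catenary,
    all saturated chains from P(p) to M have the same length, and one of them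
    passes through Q right after P(p). What remains of it has length at least
    n, so the dimension of G modulo the image of Q is at least that of R/p.

    Upper bound (graded_chain_upper_bound). Let p be a minimal prime of R and
    Q minimal over P(p) + uS inside M. Since p is associated in R, P(p) is the
    annihilator of an element of S, and since u is regular, Q is then
    associated to uS (regular_min_over_assoc, by Nakayama). So the image of Q
    is an associated prime of G; under (S1) it is a minimal prime. A chain of
    length n starting above Q and ending in N gives a chain of length n + 1
    from P(p) to N, and N contracts to m. The dimension inequality bounds its
    length by d + 1, where d is the length of the chains from p to m in R. To
    prove it, S is presented as the image of R[x_0, ..., x_k], with x_0 going
    to u and the other variables to a/u for generators a of m. In a polynomial
    ring A[x] that is Noetherian and catenary, extending the primes of a
    saturated chain of A gives a saturated chain (poly_ext_covers), and at
    most one more step is needed inside a fibre (fiber_covers). Thus every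
    variable adds at most one to the length; but the kernel of evaluation at
    a/u contains u x - a, and takes this step back (eval_chain_len).

    Everything happens in rings that are finitely generated over R, where
    catenarity is the hypothesis on R and Noetherianity is Hilbert's basis
    theorem (hilbert_basis). *)

(** * Identities in commutative rings, by reflection *)
Section RingDecision.
Variable A : comNzRingType.
Import Ring_theory Ring_polynom InitialRing BinNums.

Lemma com_ring_theory : @ring_theory A 0 1 +%R *%R (fun x y => x - y) -%R eq.
Proof.
split=> *; [exact: add0r|exact: addrC|exact: addrA|exact: mul1r|exact: mulrC
  |exact: mulrA|exact: mulrDl|by []|exact: subrr].
Qed.

(** The carrier is a canonical structure, so that the interpretation has to be
    matched with a goal up to conversion: the operations of the goal may reach
    the ring structure along different inheritance paths. *)
Definition ring_eval (l : list A) (e : PExpr Z) : A :=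
  PEeval 0 1 +%R *%R (fun x y => x - y) -%R
    (gen_phiZ 0 1 +%R *%R -%R) id_phi_N (pow_N 1 *%R) l e.

Lemma ring_decide (l : list A) (e1 e2 : PExpr Z) :
  Peq BinInt.Z.eqb
    (norm_subst (Z0) (Zpos xH) BinInt.Z.add BinInt.Z.mul BinInt.Z.sub BinInt.Z.opp BinInt.Z.eqb
       BinInt.Z.quotrem 0 nil e1)
    (norm_subst (Z0) (Zpos xH) BinInt.Z.add BinInt.Z.mul BinInt.Z.sub BinInt.Z.opp BinInt.Z.eqb
       BinInt.Z.quotrem 0 nil e2) = true ->
  ring_eval l e1 = ring_eval l e2.
Proof.
have ext := Eq_ext +%R *%R (@GRing.opp A).
apply: (@ring_correct A 0 1 +%R *%R _ -%R eq (Eqsth A) ext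
  (Rth_ARth (Eqsth A) ext com_ring_theory) _ _ _ _ _ _ _ _ _
  (gen_phiZ_morph (Eqsth A) ext com_ring_theory) _ _ _
  (pow_N_th 1 *%R (Eqsth A)) _ (Ztriv_div_th (Eqsth A) _) 0 l nil e1 e2).
exact: I.
Qed.
End RingDecision.

Ltac ring_lookup x l :=
  lazymatch l with
  | cons x _ => constr:(BinNums.xH)
  | cons _ ?l' => let p := ring_lookup x l' in eval compute in (BinPos.Pos.succ p)
  end.
Ltac ring_insert x l :=
  lazymatch l with
  | context [cons x _] => l
  | _ => constr:(cons x l)
  end.
Ltac ring_atoms t l :=
  lazymatch t with
  | (?a + ?b)%R => let l := ring_atoms a l in ring_atoms b l
  | (?a * ?b)%R => let l := ring_atoms a l in ring_atoms b l
  | (- ?a)%R => ring_atoms a l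
  | 0%R => l
  | 1%R => l
  | _ => ring_insert t l
  end.
Ltac ring_quote t l :=
  lazymatch t with
  | (?a + ?b)%R => let a' := ring_quote a l in let b' := ring_quote b l in
      constr:(Ring_polynom.PEadd a' b')
  | (?a * ?b)%R => let a' := ring_quote a l in let b' := ring_quote b l in
      constr:(Ring_polynom.PEmul a' b')
  | (- ?a)%R => let a' := ring_quote a l in constr:(Ring_polynom.PEopp a')
  | 0%R => constr:(@Ring_polynom.PEO BinNums.Z)
  | 1%R => constr:(@Ring_polynom.PEI BinNums.Z)
  | _ => let p := ring_lookup t l in constr:(@Ring_polynom.PEX BinNums.Z p)
  end.
Ltac cring :=
  lazymatch goal with
  | |- @eq ?T ?a ?b =>
    let l := ring_atoms a (@nil T) in
    let l := ring_atoms b l in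
    let a' := ring_quote a l in
    let b' := ring_quote b l in
    exact (@ring_decide _ l a' b' erefl)
  end.

(** * Ideals, spans and Nakayama's lemma *)
Section IdealSets.
Variable A : comNzRingType.
Implicit Types (I J K N P Q : set A) (a b x y : A) (s : seq A).

(** Ideals and primes are kept as propositional sets, which may be improper and
    for which extensionality makes equality of sets equality of ideals. *)
Definition is_ideal I : Prop :=
  [/\ I 0, forall x y, I x -> I y -> I (x + y) & forall a x, I x -> I (a * x)].

Definition is_prime P : Prop :=
  [/\ is_ideal P, ~ P 1 & forall x y, P (x * y) -> P x \/ P y].

Lemma id0 I : is_ideal I -> I 0. Proof. by case. Qed.
Lemma idD I x y : is_ideal I -> I x -> I y -> I (x + y).
Proof. by case=> _ h _; exact: h. Qed.
Lemma idMl I a x : is_ideal I -> I x -> I (a * x).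
Proof. by case=> _ _; apply. Qed.
Lemma idMr I a x : is_ideal I -> I x -> I (x * a).
Proof. by rewrite mulrC; exact: idMl. Qed.
Lemma idN I x : is_ideal I -> I x -> I (- x).
Proof. by move=> iI; rewrite -mulN1r; exact: idMl. Qed.
Lemma idB I x y : is_ideal I -> I x -> I y -> I (x - y).
Proof. by move=> iI Ix Iy; apply: idD => //; exact: idN. Qed.
Lemma id_subl I x y : is_ideal I -> I (x - y) -> I y -> I x.
Proof. by move=> iI xy Iy; rewrite -(subrK y x); exact: idD. Qed.
Lemma id_sum I (T : Type) (r : seq T) (C : pred T) (F : T -> A) :
  is_ideal I -> (forall i, C i -> I (F i)) -> I (\sum_(i <- r | C i) F i).
Proof. by move=> iI IF; elim/big_ind: _ => //; [exact: id0|move=> x y; exact: idD]. Qed.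

Lemma prime_ideal P : is_prime P -> is_ideal P. Proof. by case. Qed.
Lemma prime1 P : is_prime P -> ~ P 1. Proof. by case. Qed.
Lemma primeM P x y : is_prime P -> P (x * y) -> P x \/ P y.
Proof. by case=> _ _; apply. Qed.
Lemma primeNM P x y : is_prime P -> ~ P x -> ~ P y -> ~ P (x * y).
Proof. by move=> pP nx ny /(primeM pP)[]. Qed.
Lemma prime_cancel P x y : is_prime P -> ~ P x -> P (x * y) -> P y.
Proof. by move=> pP nx /(primeM pP)[]. Qed.
Lemma prime_exp P x n : is_prime P -> P (x ^+ n) -> P x.
Proof.
move=> pP; elim: n => [/(prime1 pP)//|n IH]; rewrite exprS => /(primeM pP)[//|].
exact: IH.
Qed.

Lemma idealT : is_ideal (@setT A). Proof. by split. Qed.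
Lemma ideal_zero : is_ideal [set 0 : A].
Proof. by split=> //= [x y -> ->|a x ->]; rewrite ?addr0 ?mulr0. Qed.

(** The ideal I + (a). *)
Definition adjoin I a : set A := [set x | exists r, I (x - a * r)].

Lemma adjoin_ideal I a : is_ideal I -> is_ideal (adjoin I a).
Proof.
move=> iI; split=> [|x y [r xr] [t yt]|b x [r xr]].
- by exists 0; rewrite mulr0 subr0; exact: id0.
- exists (r + t); have -> : x + y - a * (r + t) = (x - a * r) + (y - a * t) by cring.
  exact: idD.
- exists (b * r); have -> : b * x - a * (b * r) = b * (x - a * r) by cring.
  exact: idMl.
Qed.

Lemma sub_adjoin I a : I `<=` adjoin I a.
Proof. by move=> x Ix; exists 0; rewrite mulr0 subr0. Qed.

Lemma adjoin_mem I a : is_ideal I -> adjoin I a a.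
Proof. by move=> iI; exists 1; rewrite mulr1 subrr; exact: id0. Qed.

Lemma adjoin_sub I J a : is_ideal J -> I `<=` J -> J a -> adjoin I a `<=` J.
Proof.
move=> iJ IJ Ja x [r /IJ h]; rewrite -(subrK (a * r) x).
by apply: idD => //; exact: idMr.
Qed.

(** The module C s_1 + ... + C s_k + J. Weighting the coefficients by a set C
    lets one recursion serve both for the ideal generated by s and for the
    ideal Q s + J of Nakayama's lemma. *)
Fixpoint wspan (C J : set A) s : set A :=
  if s is a :: s' then [set x | exists2 r, C r & wspan C J s' (x - a * r)] else J.

Definition span s : set A := wspan setT [set 0] s.

Definition noeth : Prop := forall I, is_ideal I -> exists s, I = span s.

Lemma wspan_ideal C J s : is_ideal C -> is_ideal J -> is_ideal (wspan C J s).
Proof.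
move=> iC iJ; elim: s => //= a s IH; split=> [|x y [r Cr xr] [t Ct yt]|b x [r Cr xr]].
- by exists 0; [exact: id0|rewrite mulr0 subr0; exact: id0].
- exists (r + t); first exact: idD.
  have -> : x + y - a * (r + t) = (x - a * r) + (y - a * t) by cring.
  exact: idD.
- exists (b * r); first exact: idMl.
  have -> : b * x - a * (b * r) = b * (x - a * r) by cring.
  exact: idMl.
Qed.

Lemma span_ideal s : is_ideal (span s).
Proof. by apply: wspan_ideal; [exact: idealT|exact: ideal_zero]. Qed.

Lemma sub_wspan C J s : is_ideal C -> J `<=` wspan C J s.
Proof.
move=> iC; elim: s => //= a s IH x /IH h; exists 0; first exact: id0.
by rewrite mulr0 subr0.
Qed.

Lemma span_sub I s : is_ideal I -> (forall x, x \in s -> I x) -> span s `<=` I.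
Proof.
move=> iI; elim: s => [_ x -> |a s IH sI x [r _ h]]; first exact: id0.
rewrite -(subrK (a * r) x); apply: idD => //.
  by apply: IH h => y ys; apply: sI; rewrite inE ys orbT.
by apply: idMr => //; apply: sI; rewrite mem_head.
Qed.

Lemma mem_span s x : x \in s -> span s x.
Proof.
elim: s => //= a s IH; rewrite inE => /orP[/eqP->|/IH h].
  by exists 1 => //; rewrite mulr1 subrr; exact: id0 (span_ideal s).
by exists 0 => //; rewrite mulr0 subr0.
Qed.

Lemma spanP s x :
  span s x <-> exists c : nat -> A, x = \sum_(i < size s) c i * s`_i.
Proof.
elim: s x => [|a s IH] x /=.
  by split=> [->|[c ->]]; [exists (fun=> 0)|]; rewrite big_ord0.
split=> [[r _ /IH[c E]]|[c ->]].
  exists (fun i => if i is j.+1 then c j else r).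
  by rewrite big_ord_recl /= -E addrC mulrC subrK.
exists (c 0%N) => //; apply/IH; exists (fun i => c i.+1).
by rewrite big_ord_recl /= mulrC addrAC subrr add0r.
Qed.

Lemma wspan_mul C J s x y j : is_ideal C -> is_ideal J ->
  C x -> span s y -> J j -> wspan C J s (x * y + j).
Proof.
move=> iC iJ Cx; elim: s y => [y -> Jj|a s IH y [r _ h] Jj] /=.
  by rewrite mulr0 add0r.
exists (x * r); first exact: idMr.
have -> : x * y + j - a * (x * r) = x * (y - a * r) + j by cring.
exact: IH.
Qed.

Lemma wspan_split C J s x : is_ideal J -> wspan C J s x ->
  exists2 y, span s y & J (x - y).
Proof.
move=> iJ; elim: s x => [|a s IH] x /=.
  by move=> Jx; exists 0; [|rewrite subr0].
move=> [r _ /IH[y sy h]]; exists (y + a * r).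
  by exists r => //; rewrite addrK.
by have -> : x - (y + a * r) = x - a * r - y by cring.
Qed.

(** Localising at Q is replaced by the choice of a common denominator t outside
    Q. The first generator is eliminated with the denominator t - r, which is
    outside Q since r is in Q; the remaining generators then satisfy the same
    hypothesis. *)
Lemma nakayama Q J s : is_prime Q -> is_ideal J ->
  (forall x, span s x -> exists2 t, ~ Q t & wspan Q J s (t * x)) ->
  exists2 t, ~ Q t & forall x, span s x -> J (t * x).
Proof.
move=> pQ iJ; have iQ := prime_ideal pQ.
elim: s => [_|a s IH H].
  exists 1; first exact: prime1.
  by move=> x ->; rewrite mulr0; exact: id0.
have iW := wspan_ideal s iQ iJ; have iS := span_ideal s.
have [t nt [r Qr h]] := H a (mem_span (mem_head _ _)).
have nt' : ~ Q (t - r) by move=> Qtr; apply: nt; rewrite -(subrK r t); exact: idD.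
have h' : wspan Q J s ((t - r) * a).
  by have -> : (t - r) * a = t * a - a * r by cring.
have [|t2 nt2 H2] := IH.
  move=> x sx; have [|t1 nt1 [r1 Qr1 h1]] := H x.
    by exists 0 => //; rewrite mulr0 subr0.
  exists ((t - r) * t1); first exact: primeNM.
  have -> : (t - r) * t1 * x = (t - r) * (t1 * x - a * r1) + r1 * ((t - r) * a) by cring.
  by apply: idD => //; exact: idMl.
exists (t2 * (t - r)); first exact: primeNM.
move=> x [r1 _ h1].
have -> : t2 * (t - r) * x
  = (t - r) * (t2 * (x - a * r1)) + r1 * (t2 * ((t - r) * a)) by cring.
apply: idD => //; apply: idMl => //; first exact: H2.
have [y sy Jy] := wspan_split iJ h'.
apply: (@id_subl J _ (t2 * y)) => //; last exact: H2.
by rewrite -mulrBr; exact: idMl.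
Qed.

(** * Prime ideals of Noetherian rings *)
Section Noeth.
Hypothesis nA : noeth.

(** Zorn's lemma applies because a finite set of generators of the union of a
    chain of ideals already lies in one member of the chain. The empty set is
    added to F as the union of the empty chain. *)
Lemma noeth_max (F : set (set A)) I0 : (forall I, F I -> is_ideal I) -> F I0 ->
  exists2 I, F I & forall I', F I' -> I `<=` I' -> I' = I.
Proof.
move=> Fid FI0.
have [|M [[M0|FM] Mmax]] := @Zorn_bigcup A (fun X => X = set0 \/ F X).
- move=> C CF Ctot.
  have [[X CX X0]|nC] := pselect (exists2 X, C X & X !=set0); last first.
    left; apply/seteqP; split=> // x [X CX Xx]; apply: nC.
    by exists X => //; exists x.
  have CX' Y : C Y -> Y !=set0 -> is_ideal Y.
    by move=> CY [y Yy]; case: (CF _ CY) => [Y0|/Fid//]; rewrite Y0 in Yy.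
  have iU : is_ideal (\bigcup_(Y in C) Y).
    split=> [|x y [Y CY Yx] [Z CZ Zy]|a x [Y CY Yx]].
    + by exists X => //; exact: id0 (CX' _ CX X0).
    + have iY : is_ideal Y by apply: CX' => //; exists x.
      have iZ : is_ideal Z by apply: CX' => //; exists y.
      case: (Ctot _ _ CY CZ) => h; [exists Z|exists Y] => //.
        by apply: idD => //; exact: h.
      by apply: idD => //; exact: h.
    + by exists Y => //; apply: idMl => //; apply: CX' => //; exists x.
  have [s Es] := nA iU.
  have [Y [CY Y0 sY]] : exists Y, [/\ C Y, Y !=set0 & forall x, x \in s -> Y x].
    have : forall x, x \in s -> (\bigcup_(Y in C) Y) x.
      by move=> x xs; rewrite Es; exact: mem_span.
    elim: (s) => [_|a s' IH H]; first by exists X.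
    have [|Y [CY Y0 sY]] := IH.
      by move=> x xs; apply: H; rewrite inE xs orbT.
    have [|Z CZ Za] := H a; first exact: mem_head.
    have [YZ|ZY] := Ctot _ _ CY CZ.
      exists Z; split=> [//||x]; first by exists a.
      by rewrite inE => /orP[/eqP->//|/sY/YZ].
    exists Y; split=> [//|//|x]; rewrite inE => /orP[/eqP->|/sY//].
    exact: ZY.
  have -> : \bigcup_(Y in C) Y = Y.
    apply/seteqP; split; last by move=> x Yx; exists Y.
    by rewrite Es; apply: span_sub => //; exact: CX'.
  exact: CF.
- exfalso; apply: (Mmax I0); last by right.
  by rewrite M0; split=> // /(_ 0) h; apply: h; exact: id0 (Fid _ FI0).
- exists M => // I' FI' MI'; apply/seteqP; split=> // x Ix; apply: contrapT => nMx.
  by apply: (Mmax I'); [split=> // /(_ x Ix)|right].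
Qed.

Lemma noeth_ind (Pr : set A -> Prop) :
  (forall I, is_ideal I ->
     (forall I', is_ideal I' -> I `<=` I' -> ~ I' `<=` I -> Pr I') -> Pr I) ->
  forall I, is_ideal I -> Pr I.
Proof.
move=> H I0 iI0; apply: contrapT => nI0.
have [|//|I [iI nI] mI] := @noeth_max (fun I => is_ideal I /\ ~ Pr I) I0.
  by move=> I [].
apply/nI/H => // I' iI' II' nII'; apply: contrapT => nI'; apply: nII'.
by rewrite (mI I').
Qed.

Lemma ideal_in_maximal I : is_ideal I -> ~ I 1 ->
  exists M, [/\ is_ideal M, ~ M 1, I `<=` M &
    forall J, is_ideal J -> ~ J 1 -> M `<=` J -> J = M].
Proof.
move=> iI n1; have [J []//||M [iM nM IM] mM] :=
  @noeth_max (fun J => [/\ is_ideal J, ~ J 1 & I `<=` J]) I.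
  by split.
exists M; split=> // J iJ nJ MJ; apply: mM => //; split=> //.
exact: subset_trans MJ.
Qed.

(** An ideal maximal among those that contain I and avoid T is prime: adjoining
    x or y outside of it would meet T, hence so would adjoining x y. *)
Lemma prime_avoiding (T : set A) I : T 1 -> (forall x y, T x -> T y -> T (x * y)) ->
  is_ideal I -> (forall x, I x -> ~ T x) ->
  exists P, [/\ is_prime P, I `<=` P & forall x, P x -> ~ T x].
Proof.
move=> T1 TM iI IT; have [J []//||P [iP IP PT] mP] :=
  @noeth_max (fun J => [/\ is_ideal J, I `<=` J & forall x, J x -> ~ T x]) I.
  by split.
exists P; split=> //; split=> // [/PT//|x y Pxy].
have key z : ~ P z -> exists2 w, adjoin P z w & T w.
  move=> nz; apply: contrapT => nw; apply: nz.
  rewrite -(mP (adjoin P z)); first exact: adjoin_mem.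
    split; first exact: adjoin_ideal.
      exact: subset_trans (@sub_adjoin _ _).
    by move=> w zw Tw; apply: nw; exists w.
  exact: sub_adjoin.
apply: contrapT => /not_orP[/key[v [r Pv] Tv] /key[w [t Pw] Tw]].
apply: (PT (v * w)); last exact: TM.
have -> : v * w = w * (v - x * r) + x * r * (w - y * t) + r * t * (x * y) by cring.
by do 2?apply: idD => //; exact: idMl.
Qed.

Definition min_over I Q : Prop :=
  [/\ is_prime Q, I `<=` Q & forall P, is_prime P -> I `<=` P -> P `<=` Q -> P = Q].

(** Elements of a prime Q minimal over I are nilpotent modulo I after inverting
    the complement of Q: otherwise a prime over I avoiding all f^n t with t
    outside Q would be strictly smaller than Q. *)
Lemma min_over_nilp I Q f : is_ideal I -> min_over I Q -> Q f ->
  exists n t, ~ Q t /\ I (f ^+ n * t).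
Proof.
move=> iI [pQ IQ mQ] Qf; apply: contrapT => H.
pose T := [set x | exists n t, ~ Q t /\ x = f ^+ n * t].
have [||//||P [pP IP PT]] := @prime_avoiding T I.
- by exists 0%N, 1; split; [exact: prime1|rewrite mulr1].
- move=> _ _ [n [t [nt ->]]] [k [v [nv ->]]]; exists (n + k)%N, (t * v).
  by split; [exact: primeNM|rewrite exprD; cring].
- by move=> x Ix [n [t [nt E]]]; apply: H; exists n, t; rewrite -E.
have PQ : P `<=` Q.
  move=> x Px; apply: contrapT => nx; apply: (PT x Px).
  by exists 0%N, x; rewrite mul1r.
apply: (PT f); first by rewrite (mQ P).
by exists 1%N, 1; split; [exact: prime1|rewrite mulr1].
Qed.

(** A maximal element (I : w) among those contained in Q is closed under
    cancelling elements outside Q, since (I : t w) contains (I : w). It is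
    prime: if x y is in (I : w) but x is not, then (I : x w) is still contained
    in Q, hence equal to (I : w) by maximality, and it contains y. *)
Lemma min_over_assoc I Q : is_ideal I -> min_over I Q ->
  exists w, forall a, Q a <-> I (a * w).
Proof.
move=> iI [pQ IQ mQ].
pose col w := [set a | I (a * w)].
have icol w : is_ideal (col w).
  split; rewrite /col /=; first by rewrite mul0r; exact: id0.
    by move=> x y; rewrite mulrDl; exact: idD.
  by move=> a x; rewrite -mulrA; exact: idMl.
have [||J [w -> JQ] mJ] := @noeth_max (fun J => exists2 w, J = col w & J `<=` Q) I.
- by move=> J [w -> _].
- by exists 1 => //; apply/seteqP; split=> x /=; rewrite /col /= mulr1.
have key t a : ~ Q t -> col w (t * a) -> col w a.
  move=> nt h; rewrite -(mJ (col (t * w))).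
  - by rewrite /col /= mulrA (mulrC a).
  - exists (t * w) => // x xtw; apply: (prime_cancel pQ nt); apply: JQ.
    by rewrite /col /= -mulrA mulrCA.
  - by move=> x; rewrite /col /= => h'; rewrite mulrCA; exact: idMl.
exists w => a; rewrite -/(col w a) -(mQ (col w)) //.
  split=> // [/JQ/(prime1 pQ)//|x y cxy].
  apply: contrapT => /not_orP[nx ny].
  suff xQ : ~ col (x * w) `<=` Q.
    apply: xQ => t; rewrite /col /= => h; apply: contrapT => nt.
    by apply: nx; apply: (key _ _ nt); rewrite /col /= -mulrA.
  move=> xQ; apply: ny; rewrite -(mJ (col (x * w))).
  - by rewrite /col /= mulrA (mulrC y).
  - by exists (x * w).
  - by move=> z; rewrite /col /= => h'; rewrite mulrCA; exact: idMl.
by move=> x Ix; rewrite /col /=; exact: idMr.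
Qed.

(** * Krull's principal ideal theorem *)

(** If Q is minimal over I, then the ring localised at Q is Artinian modulo I.
    By Noetherian induction on I: choose w with Q = (I : w), so that the
    statement holds for I + (w). At Q, the quotient of I + (w) by I is a vector
    space of dimension one over the residue field, so either every J_n + I
    contains w, or J_n + I meets it trivially for all large n. *)
Lemma descending_stable I Q (J : nat -> set A) : is_prime Q ->
  (forall n, is_ideal (J n)) -> (forall n, J n.+1 `<=` J n) ->
  is_ideal I ->
  (forall P, is_prime P -> I `<=` P -> P `<=` Q -> P = Q) ->
  exists n0, forall n, (n0 <= n)%N -> forall a, J n a ->
    exists2 t, ~ Q t & exists2 b, J n.+1 b & I (t * a - b).
Proof.
move=> pQ iJ dJ iI; have dJ' k n : (n <= k)%N -> J k `<=` J n.
  move=> nk; rewrite -(subnK nk); elim: (k - n)%N => // d IH.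
  by apply: subset_trans IH; rewrite addSn; exact: dJ.
move: I iI; apply: noeth_ind => I iI IH mQ.
have [IQ|nIQ] := pselect (I `<=` Q); last first.
  have [t It nt] : exists2 t, I t & ~ Q t.
    by apply: contrapT => H; apply: nIQ => x Ix; apply: contrapT => nQ; apply: H; exists x.
  exists 0%N => n _ a _; exists t => //; exists 0; first exact: id0.
  by rewrite subr0; exact: idMr.
have [w Qw] : exists w, forall a, Q a <-> I (a * w) by exact: min_over_assoc.
have nIw : ~ I w by rewrite -[w]mul1r -Qw; exact: prime1.
have [||||n1 H1] := IH (adjoin I w).
- exact: adjoin_ideal.
- exact: sub_adjoin.
- by move=> /(_ _ (adjoin_mem w iI)).
- by move=> P pP IP; apply: mQ => //; apply: subset_trans IP; exact: sub_adjoin.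
pose inJ n := exists2 t, ~ Q t & exists2 b, J n b & I (t * w - b).
have [allJ|] := pselect (forall n, inJ n).
  exists n1 => n /H1 H a /H[t nt [b Jb [c Ic]]].
  have [t' nt' [b' Jb' Ib']] := allJ n.+1.
  exists (t' * t); first exact: primeNM.
  exists (t' * b + c * b').
    by apply: idD => //; apply: idMl.
  have -> : t' * t * a - (t' * b + c * b')
    = t' * (t * a - b - w * c) + c * (t' * w - b') by cring.
  by apply: idD => //; exact: idMl.
move=> /existsNP[n2 nn2]; exists (maxn n1 n2) => n; rewrite geq_max => /andP[nn1 nn].
move=> a Ja; have [t nt [b Jb [c Ic]]] := H1 n nn1 a Ja.
exists t => //; exists b => //.
apply: (@id_subl I _ (w * c)) => //; rewrite mulrC; apply/Qw.
apply: contrapT => nc; apply: nn2; exists c => //; exists (t * a - b).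
  apply: (dJ' n n2) => //; apply: idB => //; first exact: idMl.
  exact: dJ.
have -> : c * w - (t * a - b) = - (t * a - b - w * c) by cring.
exact: idN.
Qed.

(** The ideal q^n + P0, where the successor step q (q^n + P0) + P0 is taken as
    the intersection of all ideals that contain it. *)
Fixpoint pow_mod (P0 q : set A) n : set A := if n is k.+1 then
  [set x | forall K, is_ideal K -> P0 `<=` K ->
     (forall a b, q a -> pow_mod P0 q k b -> K (a * b)) -> K x] else setT.

Lemma pow_mod_ideal P0 q n : is_ideal (pow_mod P0 q n).
Proof.
case: n => [|n]; first exact: idealT.
split=> [K iK|x y xW yW K iK PK HK|a x xW K iK PK HK]; first by move=> *; exact: id0.
  by apply: idD => //; [exact: xW|exact: yW].
by apply: idMl => //; exact: xW.
Qed.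

Lemma pow_mod_mul P0 q n a b : q a -> pow_mod P0 q n b -> pow_mod P0 q n.+1 (a * b).
Proof. by move=> qa Wb K iK _; exact. Qed.

Lemma pow_modS P0 q n : is_ideal q -> pow_mod P0 q n.+1 `<=` pow_mod P0 q n.
Proof.
move=> iq; elim: n => [//|n IH] x Wx K iK PK HK; apply: Wx => // a b qa Wb.
by apply: HK => //; exact: IH.
Qed.

(** The n-th symbolic power of q modulo P0. *)
Definition symbolic_pow P0 q n : set A := [set x | exists2 t, ~ q t & pow_mod P0 q n (t * x)].

Lemma symbolic_pow_ideal P0 q n : is_prime q -> is_ideal (symbolic_pow P0 q n).
Proof.
move=> pq; have iW := pow_mod_ideal P0 q n.
split=> [|x y [t nt tx] [v nv vy]|a x [t nt tx]].
- by exists 1; [exact: prime1|rewrite mulr0; exact: id0].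
- exists (t * v); first exact: primeNM.
  have -> : t * v * (x + y) = v * (t * x) + t * (v * y) by cring.
  by apply: idD => //; exact: idMl.
- by exists t => //; rewrite mulrCA; exact: idMl.
Qed.

Lemma symbolic_pow_cancel P0 q n t x : is_prime q -> ~ q t ->
  symbolic_pow P0 q n (t * x) -> symbolic_pow P0 q n x.
Proof.
by move=> pq nt [v nv h]; exists (v * t); [exact: primeNM|rewrite -mulrA].
Qed.

(** If x is not in q, the symbolic powers of q modulo P0 stabilise modulo x at
    Q; by Nakayama at Q two consecutive ones coincide, and by Nakayama at q a
    power of q is contained in P0. So a prime minimal over P0 + (x) has height
    at most one over P0. *)
Theorem krull_principal_ideal P0 q Q x : is_prime P0 -> is_prime q -> P0 `<=` q -> q `<=` Q ->
  min_over (adjoin P0 x) Q -> q = P0 \/ q = Q.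
Proof.
move=> pP pq Pq qQ [pQ aQ mQ].
have [iP iq iQ] := And3 (prime_ideal pP) (prime_ideal pq) (prime_ideal pQ).
have [qx|nqx] := pselect (q x).
  by right; apply: mQ => //; exact: adjoin_sub.
left; apply/seteqP; split=> // a qa.
have dS n : symbolic_pow P0 q n.+1 `<=` symbolic_pow P0 q n.
  by move=> y [t nt h]; exists t => //; exact: pow_modS.
have PS n : P0 `<=` symbolic_pow P0 q n.
  move=> y Py; exists 1; first exact: prime1.
  by rewrite mul1r; case: n => [//|n] K iK PK _; exact: PK.
have [|||n /(_ n (leqnn n)) Hn] :=
  @descending_stable (adjoin P0 x) Q (symbolic_pow P0 q) pQ _ dS.
- by move=> n; exact: symbolic_pow_ideal.
- exact: adjoin_ideal.
- by move=> P; exact: mQ.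
have iS k := symbolic_pow_ideal P0 k pq.
have SS : symbolic_pow P0 q n `<=` symbolic_pow P0 q n.+1.
  have [s Es] := nA (iS n).
  have [|t nt Ht] := @nakayama Q (symbolic_pow P0 q n.+1) s pQ (iS _).
    rewrite -Es => y Sy; have [t nt [b Sb [r Pr]]] := Hn y Sy.
    exists t => //.
    (* x r is in the symbolic power and x is outside q *)
    have Sr : symbolic_pow P0 q n r.
      apply: (@symbolic_pow_cancel P0 q n x) => //.
      have -> : x * r = t * y - b - (t * y - b - x * r) by cring.
      apply: idB => //; last exact: PS.
      by apply: idB => //; [exact: idMl|exact: dS].
    have -> : t * y = x * r + (b + (t * y - b - x * r)) by cring.
    apply: wspan_mul => //; first by apply: aQ; exact: adjoin_mem.
      by rewrite -Es.
    by apply: idD => //; exact: PS.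
  move=> y Sy; apply: (@symbolic_pow_cancel P0 q n.+1 t) => //; first by move=> /qQ.
  by apply: Ht; rewrite -Es.
have iW := pow_mod_ideal P0 q.
have [s Es] := nA (iW n).
have [|t nt Ht] := @nakayama q P0 s pq iP.
  rewrite -Es => y Wy; have [|t nt h] := SS y.
    by exists 1; [exact: prime1|rewrite mul1r].
  exists t => //; apply: h.
  - exact: wspan_ideal.
  - exact: sub_wspan.
  - move=> b c qb Wc; rewrite -[b * c]addr0; apply: wspan_mul => //.
      by rewrite -Es.
    exact: id0.
have Wa k : pow_mod P0 q k (a ^+ k).
  by elim: k => // k IH; rewrite exprS; exact: pow_mod_mul.
apply: (@prime_exp P0 a n) => //; apply: (@prime_cancel P0 t) => //.
  by move=> /Pq.
by apply: Ht; rewrite -Es.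
Qed.

End Noeth.

(** Zorn's lemma for sets ordered by inclusion looks for maximal elements, so
    it is applied to the complements in Q of primes containing I. *)
Lemma min_over_exists I Q : is_prime Q -> I `<=` Q ->
  exists2 P, min_over I P & P `<=` Q.
Proof.
move=> pQ IQ.
have [|M [[pM IM] mM]] :=
  @Zorn_bigcup A (fun X => is_prime (Q `\` X) /\ I `<=` Q `\` X).
  move=> C CP Ctot; split; last first.
    by move=> x Ix; split; [exact: IQ|move=> [X /CP[_ h] Xx]; case: (h x Ix)].
  have iC X : C X -> is_prime (Q `\` X) by move=> /CP[].
  split.
  - split.
    + split; first exact: id0 (prime_ideal pQ).
      by move=> [X /iC/prime_ideal/id0[_ nX]].
    + move=> x y [Qx nx] [Qy ny]; split; first exact: idD (prime_ideal pQ) _ _.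
      move=> [X CX Xxy]; have [] : (Q `\` X) (x + y); last by [].
      apply: idD (prime_ideal (iC _ CX)) _ _; split=> // h.
        by apply: nx; exists X.
      by apply: ny; exists X.
    + move=> a x [Qx nx]; split; first exact: idMl (prime_ideal pQ) _.
      move=> [X CX Xxy]; have [] : (Q `\` X) (a * x); last by [].
      by apply: idMl (prime_ideal (iC _ CX)) _; split=> // h; apply: nx; exists X.
  - by move=> [/(prime1 pQ)].
  - move=> x y [Qxy nxy]; apply: contrapT => /not_orP[nx ny].
    have h z : ~ (Q `\` \bigcup_(X in C) X) z -> Q z -> exists2 X, C X & X z.
      by move=> nz Qz; apply: contrapT => nX; apply: nz.
    have contra X : C X -> ~ (Q `\` X) x -> ~ (Q `\` X) y -> False.
      move=> CX nx' ny'; have [] := primeM (iC _ CX) (x := x) (y := y) _ => //.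
      by split=> // Xxy; apply: nxy; exists X.
    have [Qx|nQx] := pselect (Q x); have [Qy|nQy] := pselect (Q y).
    + have [[X CX Xx] [Y CY Yy]] := (h x nx Qx, h y ny Qy).
      have [XY|YX] := Ctot _ _ CX CY.
        by apply: (contra Y CY) => -[_]; [apply; exact: XY|].
      by apply: (contra X CX) => -[_]; [|apply; exact: YX].
    + by have [X CX Xx] := h x nx Qx; apply: (contra X CX) => -[].
    + by have [X CX Xx] := h y ny Qy; apply: (contra X CX) => -[].
    + by case: (primeM pQ Qxy).
exists (Q `\` M); last by move=> x [].
split=> // P pP IP PQ; apply/seteqP; split=> // x [Qx nx].
apply: contrapT => nPx.
have EP : Q `\` ((Q `\` P) `|` M) = P.
  apply/seteqP; split=> y; first by move=> [Qy h]; apply: contrapT => nP; apply: h; left.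
  by move=> Py; have [Qy nMy] := PQ _ Py; split=> // -[[]|].
apply: (mM ((Q `\` P) `|` M)); last by rewrite EP.
by split=> [|/(_ x) h]; [exact: subsetUr|apply/nx/h; left].
Qed.

End IdealSets.

(** * Chains of primes and catenary rings *)
Section Chains.
Variable A : comNzRingType.
Implicit Types (p q r P Q : set A) (rel : set A -> set A -> Prop).

Definition covers p q : Prop :=
  p `<` q /\ forall x, is_prime x -> p `<=` x -> x `<=` q -> x = p \/ x = q.

(** One inductive notion for all chains of primes of length n from p to q: with
    strict inclusion as relation it gives chains, with covers it gives
    saturated chains. *)
Fixpoint rchain rel n p q : Prop :=
  if n is k.+1 then exists r, [/\ is_prime p, rel p r & rchain rel k r q]
  else is_prime p /\ p = q.

Notation chain := (rchain (@classical_sets.proper A)).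
Notation satchain := (rchain covers).

Lemma proper_neq p q : p `<=` q -> p <> q -> p `<` q.
Proof. by move=> pq npq; split=> // qp; apply: npq; apply/seteqP. Qed.

Lemma rchain_prime rel n p q : rchain rel n p q -> is_prime p /\ is_prime q.
Proof.
elim: n p => [|n IH] p /=; first by move=> [pp <-].
by move=> [r [pp _ /IH[]]].
Qed.

Lemma rchain_sub rel n p q : (forall p q, rel p q -> p `<=` q) ->
  rchain rel n p q -> p `<=` q.
Proof.
move=> H; elim: n p => [|n IH] p /=; first by move=> [_ <-].
by move=> [r [pp /H pr /IH]]; exact: subset_trans.
Qed.

Lemma chain_sub n p q : chain n p q -> p `<=` q.
Proof. by apply: rchain_sub => x y []. Qed.

Lemma satchain_sub n p q : satchain n p q -> p `<=` q.
Proof. by apply: rchain_sub => x y [[]]. Qed.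

Lemma rchain_concat rel n k p q r : rchain rel n p q -> rchain rel k q r ->
  rchain rel (n + k) p r.
Proof.
elim: n p => [|n IH] p /=; first by move=> [_ ->].
by move=> [x [pp px xq]] qr; exists x; split=> //; exact: IH.
Qed.

Lemma satchain_chain n p q : satchain n p q -> chain n p q.
Proof.
elim: n p => [//|n IH] p /= [r [pp [pr _] /IH h]]; by exists r.
Qed.

Lemma chain_extend n p p' q : is_prime p -> p `<=` p' -> chain n p' q ->
  exists2 k, (n <= k)%N & chain k p q.
Proof.
move=> pp pp' c; have [->|ne] := pselect (p = p'); first by exists n.
by exists n.+1 => //; exists p'; split=> //; exact: proper_neq.
Qed.

Lemma chain_drop n k p q : (n <= k)%N -> chain k p q ->
  exists2 r, p `<=` r & chain n r q.
Proof.
elim: k p => [|k IH] p; first by rewrite leqn0 => /eqP-> h; exists p.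
rewrite leq_eqVlt => /orP[/eqP->|]; first by move=> h; exists p.
rewrite ltnS => /IH {}IH [r [_ [pr _] /IH[x rx h]]]; exists x => //.
exact: subset_trans rx.
Qed.

(** A chain that is not saturated can be lengthened, so that a chain of maximal
    length is saturated. *)
Lemma chain_refine n p q : chain n p q -> satchain n p q \/ chain n.+1 p q.
Proof.
elim: n p => [|n IH] p; first by left.
move=> [r [pp pr c]]; have [s|c'] := IH _ c; last by right; exists r.
have [cov|] := pselect (covers p r); first by left; exists r.
move=> ncov; right; apply: contrapT => nc; apply: ncov; split=> // x px p_x xr.
apply: contrapT => /not_orP[nxp nxr]; apply: nc; exists x; split=> //.
  by apply: proper_neq => // E; apply: nxp.
by exists r; split=> //; exact: proper_neq.
Qed.

Definition catenary_set : Prop := forall p q, is_prime p -> is_prime q -> p `<=` q ->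
  (exists N, forall n, chain n p q -> (n <= N)%N) /\
  (forall n n', satchain n p q -> satchain n' p q -> n = n').

(** In a catenary ring N is both the length of every saturated chain and the
    largest length of a chain from p to q. *)
Definition chain_len p q N := satchain N p q /\ forall n, chain n p q -> (n <= N)%N.

Lemma satchain_of_bounded N n p q : (forall n, chain n p q -> (n <= N)%N) ->
  chain n p q -> exists2 m, (n <= m)%N & satchain m p q.
Proof.
move=> bN; elim: {n}(N - n)%N {-2}n (erefl (N - n)%N) => [|d IH] n E c.
  have [s|/bN] := chain_refine c; first by exists n.
  by move/eqP: E; rewrite subn_eq0 => h h'; have := leq_trans h' h; rewrite ltnn.
have [s|c'] := chain_refine c; first by exists n.
have [|m nm s] := IH n.+1 _ c'; first by rewrite subnS E.
by exists m => //; exact: ltnW.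
Qed.

Hypothesis catA : catenary_set.

Lemma satchain_len n p q : satchain n p q -> chain_len p q n.
Proof.
move=> s; split=> // k ck.
have [pp pq] := rchain_prime s; have [[N bN] uniq] := catA pp pq (satchain_sub s).
have [m km sm] := satchain_of_bounded bN ck.
by rewrite (uniq _ _ s sm).
Qed.

Lemma chain_len_exists p q : is_prime p -> is_prime q -> p `<=` q -> exists N, chain_len p q N.
Proof.
move=> pp pq pq'; have [[N bN] _] := catA pp pq pq'.
have c0 : chain 0 q q by [].
have [k _ c] := chain_extend pp pq' c0.
by have [m _ /satchain_len lm] := satchain_of_bounded bN c; exists m.
Qed.

(** In a catenary ring, saturated chains from p0 to M through q are as long as
    any chain from p0 to M, so removing the step from p0 to q costs one. *)
Lemma chain_over_cover p0 q M n : covers p0 q -> is_prime p0 -> is_prime q ->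
  is_prime M -> q `<=` M -> chain n.+1 p0 M -> exists2 r, q `<=` r & chain n r M.
Proof.
move=> cov pp0 pq pM qM c; have [b [sb _]] := chain_len_exists pq pM qM.
have s1 : satchain 1 p0 q by exists q.
have [_ /(_ _ c)] := satchain_len (rchain_concat s1 sb); rewrite add1n ltnS => nb.
exact: chain_drop nb (satchain_chain sb).
Qed.

End Chains.
Notation chain := (rchain (@classical_sets.proper _)).
Notation satchain := (rchain (@covers _)).

(** * Transport along ring morphisms *)
Section Preimage.
Variables (A B : comNzRingType) (f : {rmorphism A -> B}).
Implicit Types (P Q : set B).

Lemma preim_ideal P : is_ideal P -> is_ideal (f @^-1` P).
Proof.
move=> iP; split; rewrite /preimage /=; first by rewrite rmorph0; exact: id0.
  by move=> x y; rewrite rmorphD; exact: idD.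
by move=> a x; rewrite rmorphM; exact: idMl.
Qed.

Lemma preim_prime P : is_prime P -> is_prime (f @^-1` P).
Proof.
move=> pP; split; first exact: preim_ideal (prime_ideal pP).
  by rewrite /preimage /= rmorph1; exact: prime1.
by move=> x y; rewrite /preimage /= rmorphM; exact: primeM.
Qed.

Hypothesis f_surj : forall b, exists a, f a = b.

Lemma preim_sub P Q : f @^-1` P `<=` f @^-1` Q -> P `<=` Q.
Proof. by move=> h x; have [a <-] := f_surj x => /h. Qed.

Lemma preim_image (K : set A) : is_ideal K -> (forall x, f x = 0 -> K x) ->
  f @^-1` (f @` K) = K.
Proof.
move=> iK kK; apply/seteqP; split=> x; last by move=> Kx; exists x.
move=> [y Ky E]; apply: (@id_subl _ K x y) => //; apply: kK.
by rewrite rmorphB E subrr.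
Qed.

Lemma image_ideal (K : set A) : is_ideal K -> is_ideal (f @` K).
Proof.
move=> iK; split; first by exists 0; [exact: id0|rewrite rmorph0].
  by move=> _ _ [x Kx <-] [y Ky <-]; exists (x + y); [exact: idD|rewrite rmorphD].
move=> b _ [x Kx <-]; have [a <-] := f_surj b.
by exists (a * x); [exact: idMl|rewrite rmorphM].
Qed.

Lemma image_prime (K : set A) : is_prime K -> (forall x, f x = 0 -> K x) ->
  is_prime (f @` K).
Proof.
move=> pK kK; have E := preim_image (prime_ideal pK) kK.
have inK x : (f @` K) (f x) -> K x by move=> h; rewrite -E.
split; first exact: image_ideal (prime_ideal pK).
  by rewrite -(rmorph1 f) => /inK; exact: prime1.
move=> b c; have [x <-] := f_surj b; have [y <-] := f_surj c.
by rewrite -rmorphM => /inK/(primeM pK)[]; [left; exists x|right; exists y].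
Qed.

Lemma preim_proper P Q : P `<` Q -> f @^-1` P `<` f @^-1` Q.
Proof.
move=> [PQ nQP]; split; first by move=> x /PQ.
by move=> /preim_sub.
Qed.

Lemma preim_chain n P Q : chain n P Q -> chain n (f @^-1` P) (f @^-1` Q).
Proof.
elim: n P => [|n IH] P /=.
  by move=> [pP <-]; split=> //; exact: preim_prime.
move=> [r [pP Pr /IH h]]; exists (f @^-1` r); split=> //.
  exact: preim_prime.
exact: preim_proper.
Qed.

(** A prime between two preimages contains the kernel, hence is a preimage. *)
Lemma preim_covers P Q : is_prime P -> covers P Q -> covers (f @^-1` P) (f @^-1` Q).
Proof.
move=> pP [PQ cov]; split; first exact: preim_proper.
move=> x px Px xQ; have kx a : f a = 0 -> x a.
  move=> fa; apply: Px; rewrite /preimage /= fa; exact: id0 (prime_ideal pP).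
have E := preim_image (prime_ideal px) kx; rewrite -E.
have [|||->|->] := cov (f @` x); [exact: image_prime| | |by left|by right].
  by apply: preim_sub; rewrite E.
by apply: preim_sub; rewrite E.
Qed.

Lemma preim_satchain n P Q : satchain n P Q -> satchain n (f @^-1` P) (f @^-1` Q).
Proof.
elim: n P => [|n IH] P /=; first by move=> [pP <-]; split=> //; exact: preim_prime.
move=> [r [pP Pr /IH h]]; exists (f @^-1` r); split=> //.
  exact: preim_prime.
exact: preim_covers.
Qed.

Lemma image_chain n (P Q : set A) : (forall x, f x = 0 -> P x) -> chain n P Q ->
  chain n (f @` P) (f @` Q).
Proof.
elim: n P => [|n IH] P kP /=; first by move=> [pP <-]; split=> //; exact: image_prime.
move=> [r [pP Pr c]]; have kr x : f x = 0 -> r x by move=> /kP; case: Pr => + _; exact.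
exists (f @` r); split; [exact: image_prime| |exact: IH].
have [pr _] := rchain_prime c.
split; first by apply: image_subset; case: Pr.
move=> h; case: Pr => _; apply; rewrite -(preim_image (prime_ideal pP) kP).
by rewrite -(preim_image (prime_ideal pr) kr) => x /h.
Qed.

Lemma catenary_set_surj : catenary_set A -> catenary_set B.
Proof.
move=> cA P Q pP pQ PQ.
have [||//|[N bN] uniq] := cA (f @^-1` P) (f @^-1` Q); [exact: preim_prime..|by move=> x /PQ|].
split; first by exists N => n /preim_chain/bN.
by move=> n n' /preim_satchain s /preim_satchain; exact: uniq.
Qed.

Lemma span_map (s : seq A) x : span s x -> span (map f s) (f x).
Proof.
elim: s x => [|a s IH] x /=; first by move=> ->; exact: rmorph0.
by move=> [r _ /IH h]; exists (f r) => //; rewrite -rmorphM -rmorphB.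
Qed.

Lemma noeth_surj : noeth A -> noeth B.
Proof.
move=> nA I iI; have [s Es] := nA _ (preim_ideal iI).
exists (map f s); apply/seteqP; split.
  move=> b; have [a <-] := f_surj b => Ia; apply: span_map.
  by rewrite -Es.
apply: span_sub => // _ /mapP[a sa ->].
by have : span s a by [exact: mem_span]; rewrite -Es.
Qed.

End Preimage.

Lemma ex_min (T : Type) (m : T -> nat) (D : T -> Prop) x0 : D x0 ->
  exists2 x, D x & forall y, D y -> (m x <= m y)%N.
Proof.
move=> D0; pose P n := `[<exists2 x, D x & m x = n>].
have : exists n, P n by exists (m x0); apply/asboolP; exists x0.
case/ex_minnP => n /asboolP[x Dx mx] H; exists x => // y Dy.
by rewrite mx; apply: H; apply/asboolP; exists y.
Qed.

(** * Prime ideals of a polynomial ring *)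
Section ExtendedIdeals.
Variable A : comNzRingType.
Implicit Types (p q : set A) (P X : set {poly A}) (f g h : {poly A}).

Definition poly_ext p : set {poly A} := [set f | forall i, p f`_i].

Lemma poly_ext_ideal p : is_ideal p -> is_ideal (poly_ext p).
Proof.
move=> ip; split=> [i|f g pf pg i|f g pg i].
- by rewrite coef0; exact: id0.
- by rewrite coefD; exact: idD.
- by rewrite coefM; apply: id_sum => // j _; exact: idMl.
Qed.

Lemma poly_ext_const p a : is_ideal p -> poly_ext p a%:P <-> p a.
Proof.
move=> ip; split=> [/(_ 0%N)|pa i]; first by rewrite coefC.
by rewrite coefC; case: eqP => // _; exact: id0.
Qed.

(** If i and j are the least indices of coefficients of f and g outside p, then
    the coefficient of f g at i + j is congruent to f_i g_j modulo p. *)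
Lemma poly_ext_prime p : is_prime p -> is_prime (poly_ext p).
Proof.
move=> pp; have ip := prime_ideal pp; split; first exact: poly_ext_ideal.
  by move=> /(poly_ext_const _ ip); exact: prime1.
move=> f g pfg; apply: contrapT => /not_orP[/existsNP[i0 ni] /existsNP[j0 nj]].
have [i {}ni mi] := @ex_min nat id (fun i => ~ p f`_i) i0 ni.
have [j {}nj mj] := @ex_min nat id (fun j => ~ p g`_j) j0 nj.
apply: (primeNM pp ni nj).
have := pfg (i + j)%N; rewrite coefM.
have ij : (i < (i + j).+1)%N by rewrite ltnS leq_addr.
rewrite (bigD1 (Ordinal ij)) //= addKn => h.
rewrite -[X in p X](addrK (\sum_(k < (i + j).+1 | k != Ordinal ij) f`_k * g`_(i + j - k))).
apply: idB => //.
apply: id_sum => // k; rewrite -val_eqE /= => ki.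
have [{}ki|ik] := ltnP k i.
  by apply: idMr => //; apply: contrapT => /mi; rewrite leqNgt ki.
apply: idMl => //; apply: contrapT => /mj; apply/negP; rewrite -ltnNge.
have kij : (k <= i + j)%N by rewrite -ltnS.
by rewrite ltn_subLR // ltn_add2r ltn_neqAle eq_sym ki.
Qed.

Lemma poly_ext_gen p P : is_ideal P -> (forall a, p a -> P a%:P) -> poly_ext p `<=` P.
Proof.
move=> iP h f pf; rewrite -[f]coefK poly_def; apply: id_sum => // i _.
by rewrite -mul_polyC; apply: idMr => //; exact: h.
Qed.

Definition poly_contr P : set A := polyC @^-1` P.

Lemma poly_contr_prime P : is_prime P -> is_prime (poly_contr P).
Proof. exact: preim_prime. Qed.

(** Choose a in q outside p. Then q[x] is minimal over p[x] + (a), as a prime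
    in between contracts to q; so the principal ideal theorem in A[x]
    forbids any prime strictly between p[x] and q[x]. *)
Lemma poly_ext_covers p q : noeth {poly A} -> is_prime p -> is_prime q ->
  covers p q -> covers (poly_ext p) (poly_ext q).
Proof.
move=> nA pp pq [[pq' nqp] cov]; have [ip iq] := (prime_ideal pp, prime_ideal pq).
have [a qa npa] : exists2 a, q a & ~ p a.
  by apply: contrapT => H; apply: nqp => x qx; apply: contrapT => nx; apply: H; exists x.
have pe : poly_ext p `<=` poly_ext q by move=> f h i; apply: pq'.
split.
  by split=> // /(_ a%:P); rewrite !poly_ext_const // => /(_ qa).
move=> X pX pX' Xq.
apply: (@krull_principal_ideal _ nA (poly_ext p) X (poly_ext q) a%:P) => //; first exact: poly_ext_prime.
split; [exact: poly_ext_prime| |].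
  by apply: adjoin_sub => //; [exact: poly_ext_ideal|apply/poly_ext_const].
move=> P pP aP PeQ; have iP := prime_ideal pP; apply/seteqP; split=> //.
apply: poly_ext_gen => // b qb.
have [||E|E] := cov (poly_contr P) (poly_contr_prime pP); last first.
- by have : (poly_contr P) b by rewrite E.
- case: npa; rewrite -E; apply: aP.
  exact: adjoin_mem (poly_ext_ideal ip).
- by move=> x /PeQ/(poly_ext_const _ iq).
- by move=> x px; apply/aP/sub_adjoin/poly_ext_const.
Qed.

Lemma poly_reduce f g : g != 0 -> exists k : nat, exists q : {poly A}, exists r : {poly A},
  [/\ (lead_coef g ^+ k)%:P * f = q * g + r & (size r < size g)%N].
Proof.
move=> g0; have := Pdiv.ComRing.rdivp_eq g f.
set k := Pdiv.Ring.rscalp _ _; move=> E; exists k.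
exists (Pdiv.Ring.rdivp f g), (Pdiv.Ring.rmodp f g); rewrite mul_polyC E; split=> //.
exact: Pdiv.Ring.ltn_rmodpN0.
Qed.

(** If the leading coefficient were in p, the leading term would lie in X, and
    dropping it would give an element of smaller degree outside X. *)
Lemma min_lead p X P f : is_ideal p -> is_ideal X -> is_ideal P -> poly_ext p `<=` X ->
  X `<=` P -> P f -> ~ X f ->
  (forall g, P g -> ~ X g -> (size f <= size g)%N) -> ~ p (lead_coef f).
Proof.
move=> ip iX iP pX XP Pf nXf mf pl.
pose g := f - (lead_coef f)%:P * 'X^((size f).-1).
have X1 : X ((lead_coef f)%:P * 'X^((size f).-1)).
  by apply: idMr => //; apply/pX/poly_ext_const.
have f0 : f != 0 by apply: contraPneq nXf => ->; apply; exact: id0.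
have : (size f <= size g)%N.
  apply: mf; first by apply: idB => //; exact: XP.
  by move=> Xg; apply: nXf; exact: id_subl Xg _.
rewrite leqNgt; apply/negP; rewrite negbK.
have sf : (0 < size f)%N by rewrite size_poly_gt0.
rewrite -[X in (_ < X)%N](prednK sf) ltnS; apply/leq_sizeP => j.
rewrite leq_eqVlt => /orP[/eqP<-|jf]; rewrite coefB mul_polyC coefZ coefXn.
  by rewrite eqxx mulr1 lead_coefE subrr.
rewrite (gtn_eqF jf) mulr0 subr0 nth_default //.
by rewrite -(prednK sf).
Qed.

(** The fibre over p is a polynomial ring in one variable over a field, where
    chains of primes have length at most one. To avoid the fraction field, an
    intermediate prime X is refuted by pseudo-division: take f of least degree
    in X outside p[x] and g of least degree in P outside X. Dividing g by f
    shows that deg g < deg f. Dividing f by g leaves a remainder in p[x] and a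
    quotient q in X outside p[x]; so q has degree at least deg f modulo p,
    which makes q g too large unless g is constant, which is impossible as P
    contracts to p. *)
Lemma fiber_covers p P : is_prime p -> is_prime P -> poly_contr P = p -> poly_ext p <> P ->
  covers (poly_ext p) P.
Proof.
move=> pp pP cP neP; have [ip iP] := (prime_ideal pp, prime_ideal pP).
have ePP : poly_ext p `<=` P by apply: poly_ext_gen => // a; rewrite -cP.
split; first exact: proper_neq.
move=> X pX eX XP; apply: contrapT => /not_orP[nXe nXP].
have iX := prime_ideal pX; have pe := poly_ext_prime pp; have ie := prime_ideal pe.
have cX a : X a%:P -> p a by move=> /XP; rewrite -cP.
have [f0 Xf0 nf0] : exists2 f, X f & ~ poly_ext p f.
  apply: contrapT => H; apply: nXe; apply/seteqP; split=> // f Xf.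
  by apply: contrapT => nf; apply: H; exists f.
have [g0 Pg0 ng0] : exists2 g, P g & ~ X g.
  apply: contrapT => H; apply: nXP; apply/seteqP; split=> // f Xf.
  by apply: contrapT => nf; apply: H; exists f.
have [f [Xf nf] mf] := @ex_min _ (fun f : {poly A} => size f) (fun f => X f /\ ~ poly_ext p f) f0 (conj Xf0 nf0).
have [g [Pg ng] mg] := @ex_min _ (fun f : {poly A} => size f) (fun f => P f /\ ~ X f) g0 (conj Pg0 ng0).
have lf : ~ p (lead_coef f).
  by apply: (@min_lead p (poly_ext p) X) => // h Xh nh; apply: mf.
have lg : ~ p (lead_coef g).
  by apply: (@min_lead p X P) => // h Xh nh; apply: mg.
have lXn a k : ~ p a -> ~ X (a ^+ k)%:P by move=> na /cX/(prime_exp pp).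
have fz : f != 0 by apply: contraPneq nf => ->; apply; exact: id0.
have gz : g != 0 by apply: contraPneq ng => ->; apply; exact: id0.
have gf : (size g < size f)%N.
  rewrite ltnNge; apply/negP => fg.
  have [k [q [r [E sr]]]] := poly_reduce g fz.
  have Er : r = (lead_coef f ^+ k)%:P * g - q * f by rewrite E addrAC subrr add0r.
  have : (size g <= size r)%N.
    apply: mg; split.
      by rewrite Er; apply: idB => //; apply: idMl => //; exact: XP.
    move=> Xr; apply: ng; apply: (prime_cancel pX (lXn _ k lf)); rewrite E.
    by apply: idD => //; exact: idMl.
  by rewrite leqNgt (leq_trans sr).
have [k [q [r [E sr]]]] := poly_reduce f gz.
have Er : r = (lead_coef g ^+ k)%:P * f - q * g by rewrite E addrAC subrr add0r.
have Pr : P r by rewrite Er; apply: idB => //; apply: idMl => //; exact: XP.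
have Xr : X r by apply: contrapT => nr; have := mg r (conj Pr nr); rewrite leqNgt sr.
have er : poly_ext p r.
  by apply: contrapT => nr; have := mf r (conj Xr nr); rewrite leqNgt (ltn_trans sr).
have Xq : X q.
  apply: (prime_cancel pX ng); rewrite mulrC.
  have -> : q * g = (lead_coef g ^+ k)%:P * f - r by rewrite E addrK.
  by apply: idB => //; exact: idMl.
have nq : ~ poly_ext p q.
  move=> eq; apply: nf; apply: (prime_cancel pe (x := (lead_coef g ^+ k)%:P)).
    by move=> /(poly_ext_const _ ip)/(prime_exp pp).
  by rewrite E; apply: (idD ie) => //; exact: (idMr _ ie).
(* j is the degree of q modulo p; q truncated there is still in X outside p[x] *)
have [j nj mj] : exists2 j, ~ p q`_j & forall i, (j < i)%N -> p q`_i.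
  have [j0 nj0] : exists j, ~ p q`_j by exact/existsNP.
  have [j nj mj] := @ex_min nat (fun j => size q - j)%N (fun j => ~ p q`_j) j0 nj0.
  exists j => // i ji; apply: contrapT => ni; have := mj i ni.
  rewrite leqNgt ltn_sub2l //; apply: (leq_trans ji).
  by rewrite leqNgt; apply/negP => qi; apply: ni; rewrite nth_default ?(ltnW qi) //; exact: id0.
have fj : (size f <= j.+1)%N.
  pose q' := take_poly j.+1 q.
  apply: leq_trans (size_take_poly j.+1 q); apply: mf.
  have pq' : poly_ext p (q - q').
    move=> i; rewrite coefB coef_take_poly; case: ltnP => ji.
      by rewrite subrr; exact: id0.
    by rewrite subr0; exact: mj.
  have Eq' : q' = q - (q - q') by rewrite opprB addrC subrK.
  split; first by rewrite -/q' Eq'; apply: idB => //; exact: eX.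
  by move=> /(_ j); rewrite coef_take_poly ltnSn.
have sg : (1 < size g)%N.
  rewrite ltnNge; apply/negP => /size1_polyC Eg; apply: lg.
  by rewrite Eg lead_coefC -cP /poly_contr /preimage /= -Eg.
apply: (primeNM pp nj lg).
have : p ((lead_coef g ^+ k)%:P * f - r)`_(j + (size g).-1).
  rewrite coefB; apply: idB => //.
  rewrite mul_polyC coefZ nth_default ?mulr0; first exact: id0.
  by apply: leq_trans fj _; rewrite -addn1 leq_add2l -ltnS prednK // ltnW.
rewrite E addrK coefM.
have jj : (j < (j + (size g).-1).+1)%N by rewrite ltnS leq_addr.
rewrite (bigD1 (Ordinal jj)) //= addKn -lead_coefE => h.
rewrite -[X in p X](addrK (\sum_(i < (j + (size g).-1).+1 | i != Ordinal jj)
  q`_i * g`_(j + (size g).-1 - i))).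
apply: idB => //.
apply: id_sum => // i; rewrite -val_eqE /= => ij.
have [{}ij|ji] := ltnP j i; first by apply: idMr => //; exact: mj.
rewrite [X in _ * X]nth_default ?mulr0; first exact: id0.
have : (i < j)%N by rewrite ltn_neqAle ij.
move: (nat_of_ord i) => n nj'; rewrite -addnBAC ?(ltnW nj') //.
by rewrite -{1}(prednK (ltnW sg)) -add1n leq_add2r subn_gt0.
Qed.

Lemma poly_ext_satchain n p q : noeth {poly A} -> satchain n p q ->
  satchain n (poly_ext p) (poly_ext q).
Proof.
move=> nA; elim: n p => [|n IH] p /=; first by move=> [pp <-]; split=> //; exact: poly_ext_prime.
move=> [r [pp pr s]]; have [prr _] := rchain_prime s.
exists (poly_ext r); split; [exact: poly_ext_prime|exact: poly_ext_covers|exact: IH].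
Qed.

Lemma poly_satchain n p P : noeth {poly A} -> is_prime P ->
  satchain n p (poly_contr P) -> exists2 k, (k <= n.+1)%N & satchain k (poly_ext p) P.
Proof.
move=> nA pP s; have s' := poly_ext_satchain nA s; have [pp pc] := rchain_prime s.
have [E|ne] := pselect (poly_ext (poly_contr P) = P).
  by exists n => //; rewrite -[X in rchain _ _ _ X]E.
exists (n + 1)%N; first by rewrite addn1.
apply: rchain_concat s' _; exists P; split=> //; first exact: poly_ext_prime.
exact: fiber_covers.
Qed.

End ExtendedIdeals.

(** * Hilbert's basis theorem *)
Section AscendingChains.
Variable A : comNzRingType.
Hypothesis nA : noeth A.

Lemma noeth_acc (L : nat -> set A) : (forall n, is_ideal (L n)) ->
  (forall n, L n `<=` L n.+1) -> exists N, forall n, (N <= n)%N -> L n = L N.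
Proof.
move=> iL dL.
have [I [n <-]//||_ [N <-] mN] := noeth_max nA (F := fun I => exists n, L n = I) (I0 := L 0%N).
  by exists 0%N.
exists N => n Nn; apply: mN; first by exists n.
rewrite -(subnK Nn); elim: (n - N)%N => // d IH.
by rewrite addSn; apply: subset_trans IH _.
Qed.

Lemma span_subset (s t : seq A) : {subset s <= t} -> span s `<=` span t.
Proof. by move=> st; apply: span_sub => [|x /st]; [exact: span_ideal|exact: mem_span]. Qed.
End AscendingChains.

Section HilbertBasis.
Variable A : comNzRingType.
Hypothesis nA : noeth A.
Implicit Types (I : set {poly A}).

Definition leading I n : set A :=
  [set a | exists f : {poly A}, [/\ I f, (size f <= n.+1)%N & f`_n = a]].

Lemma leading_ideal I n : is_ideal I -> is_ideal (leading I n).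
Proof.
move=> iI; split=> [|_ _ [f [If sf <-]] [g [Ig sg <-]]|a _ [f [If sf <-]]].
- by exists 0; split; [exact: id0|rewrite size_poly0|rewrite coef0].
- exists (f + g); split; [exact: idD| |by rewrite coefD].
  by apply: leq_trans (size_polyD _ _) _; rewrite geq_max sf.
- exists (a%:P * f); split; [exact: idMl| |by rewrite coefCM].
  by rewrite mul_polyC; apply: leq_trans (size_scale_leq _ _) _.
Qed.

Lemma leadingS I n : is_ideal I -> leading I n `<=` leading I n.+1.
Proof.
move=> iI _ [f [If sf <-]]; exists (f * 'X); split; [exact: idMr| |by rewrite coefMX].
by apply: leq_trans (size_polyMleq _ _) _; rewrite size_polyX addn2.
Qed.

Lemma leading_lift I n (t : seq A) : is_ideal I -> (forall a, a \in t -> leading I n a) ->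
  exists2 s : seq {poly A}, (forall f, f \in s -> I f) &
    forall a, span t a -> exists g, [/\ span s g, (size g <= n.+1)%N & g`_n = a].
Proof.
move=> iI; elim: t => [_|a t IH H].
  by exists [::] => // a ->; exists 0; split; rewrite ?size_poly0 ?coef0.
have [|s sI Hs] := IH; first by move=> b bt; apply: H; rewrite inE bt orbT.
have [f [If sf fa]] := H a (mem_head _ _).
exists (f :: s); first by move=> h; rewrite inE => /orP[/eqP->|/sI].
move=> x [r _ /Hs[g [sg zg gx]]]; exists (g + f * r%:P); split.
- by exists r%:P => //; rewrite addrK.
- apply: leq_trans (size_polyD _ _) _; rewrite geq_max zg /= mulrC mul_polyC.
  exact: leq_trans (size_scale_leq _ _) _.
- by rewrite coefD coefMC gx fa subrK.
Qed.

(** The ideals of leading coefficients form an ascending chain, which is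
    constant from some N on. Lifts of their generators in degrees up to N
    suffice to cancel the leading term of any element of I. *)
Theorem hilbert_basis : noeth {poly A}.
Proof.
move=> I iI.
have iL n := leading_ideal n iI.
have [N HN] := noeth_acc nA iL (fun n => @leadingS I n iI).
have lift n : exists2 s : seq {poly A}, (forall f, f \in s -> I f) &
    forall a, leading I n a -> exists g, [/\ span s g, (size g <= n.+1)%N & g`_n = a].
  have [t Et] := nA (iL n).
  have [|s sI Hs] := @leading_lift I n t iI; last by exists s; rewrite ?Et.
  by move=> a /mem_span; rewrite -Et.
have [s sI Hs] : exists2 s : seq {poly A}, (forall f, f \in s -> I f) &
    forall n, (n <= N)%N -> forall a, leading I n a ->
      exists g, [/\ span s g, (size g <= n.+1)%N & g`_n = a].
  elim: N {HN} => [|N [s sI Hs]].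
    have [s sI Hs] := lift 0%N; exists s => // n; rewrite leqn0 => /eqP->; exact: Hs.
  have [t tI Ht] := lift N.+1; exists (s ++ t).
    by move=> f; rewrite mem_cat => /orP[/sI|/tI].
  move=> n; rewrite leq_eqVlt => /orP[/eqP->|].
    move=> a /Ht[g [tg zg ga]]; exists g; split=> //.
    by apply: span_subset tg => x xt; rewrite mem_cat xt orbT.
  rewrite ltnS => /Hs {}Hs a /Hs[g [tg zg ga]]; exists g; split=> //.
  by apply: span_subset tg => x xt; rewrite mem_cat xt.
exists s; apply/seteqP; split; last by apply: span_sub.
have iS := span_ideal s.
have sII : span s `<=` I by exact: span_sub.
suff H n (f : {poly A}) : (size f <= n)%N -> I f -> span s f by move=> f; exact: (H (size f)).
elim: n f => [|n IH] f.
  by rewrite leqn0 size_poly_eq0 => /eqP-> _; exact: id0.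
move=> sf If.
have [g [sg zg gE]] : exists g, [/\ span s g, (size g <= n.+1)%N & g`_n = f`_n].
  have Lf : leading I n f`_n by exists f.
  have [nN|/ltnW Nn] := leqP n N; first exact: Hs Lf.
  move: Lf; rewrite (HN n Nn) => /(Hs N (leqnn N))[g [sg zg gE]].
  exists (g * 'X^(n - N)); split; first exact: idMr.
    apply: leq_trans (size_polyMleq _ _) _; rewrite size_polyXn addnS /=.
    by apply: leq_trans (leq_add zg (leqnn _)) _; rewrite addSn subnKC.
  by rewrite coefMXn ltnNge leq_subr /= subKn.
apply: (@id_subl _ _ f g) => //; apply: IH; last by apply: idB => //; exact: sII.
apply/leq_sizeP => j; rewrite leq_eqVlt coefB => /orP[/eqP<-|nj].
  by rewrite gE subrr.
by rewrite !nth_default ?subrr //; apply: leq_trans nj.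
Qed.
End HilbertBasis.

(** * Polynomial rings over a universally catenary ring *)

(** Iterated rather than multivariate polynomials, as variables are handled one
    at a time. *)
Fixpoint mpol (R : comNzRingType) n : comNzRingType :=
  if n is k.+1 then {poly (mpol R k)} : comNzRingType else R.

Lemma mpol_noeth R n : noeth R -> noeth (mpol R n).
Proof. by move=> nR; elim: n => //= n; exact: hilbert_basis. Qed.

(** Restriction of scalars along f, on a copy of the carrier so that it does not
    conflict with algebra structures of B. *)
Definition alg_of (R B : comNzRingType) (f : {rmorphism R -> B}) : Type := B.

Section AlgOf.
Variables (R B : comNzRingType) (f : {rmorphism R -> B}).
HB.instance Definition _ := GRing.ComNzRing.copy (alg_of f) B.
Definition alg_scale (a : R) (x : alg_of f) : alg_of f := (f a : alg_of f) * x.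
Fact alg_scaleA a b v : alg_scale a (alg_scale b v) = alg_scale (a * b) v.
Proof. by rewrite /alg_scale rmorphM mulrA. Qed.
Fact alg_scale1 : left_id 1 alg_scale.
Proof. by move=> x; rewrite /alg_scale rmorph1 mul1r. Qed.
Fact alg_scaleDr : right_distributive alg_scale +%R.
Proof. by move=> a x y; rewrite /alg_scale mulrDr. Qed.
Fact alg_scaleDl v : {morph alg_scale^~ v: a b / a + b}.
Proof. by move=> a b; rewrite /alg_scale rmorphD mulrDl. Qed.
HB.instance Definition _ := GRing.Zmodule_isLmodule.Build R (alg_of f)
  alg_scaleA alg_scale1 alg_scaleDr alg_scaleDl.
Fact alg_scaleAl (a : R) (u v : alg_of f) : a *: (u * v) = (a *: u) * v.
Proof. exact: mulrA. Qed.
HB.instance Definition _ := GRing.Lmodule_isLalgebra.Build R (alg_of f) alg_scaleAl.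
HB.instance Definition _ := GRing.Lalgebra_isComAlgebra.Build R (alg_of f).

Definition of_alg (x : alg_of f) : B := x.
Fact of_alg_is_zmod : zmod_morphism of_alg. Proof. by []. Qed.
Fact of_alg_is_monoid : monoid_morphism of_alg. Proof. by []. Qed.
HB.instance Definition _ := GRing.isZmodMorphism.Build (alg_of f) B of_alg of_alg_is_zmod.
HB.instance Definition _ := GRing.isMonoidMorphism.Build (alg_of f) B of_alg of_alg_is_monoid.
End AlgOf.

(** * Ideals as predicates and as sets *)
Section Bridge.
Variable A : comNzRingType.

Definition set_of_pred (S : {pred A}) : set A := [set x | x \in S].

Lemma set_of_ideal (I : idealr A) : is_ideal (set_of_pred I).
Proof.
split; rewrite /set_of_pred /=; first exact: rpred0.
  by move=> x y; exact: rpredD.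
by move=> a x; exact: idealMr.
Qed.

Lemma set_of_prime (p : prime_idealr A) : is_prime (set_of_pred p).
Proof.
split; first exact: (set_of_ideal p).
  by rewrite /set_of_pred /= idealr1.
by move=> x y; rewrite /set_of_pred /= prime_idealrM => /orP.
Qed.

Definition ideal_pred (I : set A) (iI : is_ideal I) (I1 : ~ I 1) : {pred A} :=
  fun x => `[< I x >].

Fact ideal_pred_closed I (iI : is_ideal I) (I1 : ~ I 1) : idealr_closed (ideal_pred iI I1).
Proof.
split; first by apply/asboolP; exact: id0.
  by apply/asboolP.
move=> a x y /asboolP Ix /asboolP Iy; apply/asboolP.
by apply: idD => //; exact: idMl.
Qed.
HB.instance Definition _ I (iI : is_ideal I) (I1 : ~ I 1) :=
  isIdealr.Build A (ideal_pred iI I1) (@ideal_pred_closed I iI I1).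

Lemma ideal_of_set I : is_ideal I -> ~ I 1 -> exists J : idealr A, set_of_pred J = I.
Proof.
move=> iI I1; exists (ideal_pred iI I1); apply/seteqP.
by split=> x; rewrite /set_of_pred /= => /asboolP.
Qed.

Definition prime_pred (P : set A) (pP : is_prime P) : {pred A} :=
  ideal_pred (prime_ideal pP) (prime1 pP).
HB.instance Definition _ P (pP : is_prime P) := Idealr.on (prime_pred pP).
Fact prime_pred_closed P (pP : is_prime P) : prime_idealr_closed (prime_pred pP).
Proof. by move=> x y /asboolP/(primeM pP)[] h; apply/orP; [left|right]; apply/asboolP. Qed.
HB.instance Definition _ P (pP : is_prime P) :=
  isPrimeIdealrClosed.Build A (prime_pred pP) (@prime_pred_closed P pP).

Lemma prime_of_set P : is_prime P -> exists p : prime_idealr A, set_of_pred p = P.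
Proof.
move=> pP; exists (prime_pred pP); apply/seteqP.
by split=> x; rewrite /set_of_pred /= => /asboolP.
Qed.

Lemma set_of_pred_eq (S T : {pred A}) : set_of_pred S = set_of_pred T <-> S =i T.
Proof.
split=> [E x|E].
  by apply/idP/idP => h; [have : set_of_pred T x by rewrite -E|have : set_of_pred S x by rewrite E].
by apply/seteqP; split=> x; rewrite /set_of_pred /= E.
Qed.

Lemma noetherian_noeth : noetherian A -> noeth A.
Proof.
move=> nA I iI; have [I1|nI1] := pselect (I 1).
  exists [:: 1]; apply/seteqP; split=> x _; last by rewrite -[x]mulr1; exact: idMl.
  by exists x => //; rewrite mul1r subrr.
have [J <-] := ideal_of_set iI nI1; have [s Hs] := nA J; exists s.
by apply/seteqP; split=> x; rewrite spanP; move/Hs.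
Qed.

Lemma rchain_of_seq (rel : set A -> set A -> Prop) n (c : nat -> prime_idealr A) :
  (forall i, (i < n)%N -> rel (set_of_pred (c i)) (set_of_pred (c i.+1))) ->
  rchain rel n (set_of_pred (c 0%N)) (set_of_pred (c n)).
Proof.
elim: n c => [|n IH] c H /=; first by split=> //; exact: set_of_prime.
exists (set_of_pred (c 1%N)); split; [exact: set_of_prime|exact: H|].
by apply: (IH (fun i => c i.+1)) => i ni; exact: H.
Qed.

Lemma seq_of_rchain (rel : set A -> set A -> Prop) n P Q : rchain rel n P Q ->
  exists c : nat -> prime_idealr A,
  [/\ forall i, (i < n)%N -> rel (set_of_pred (c i)) (set_of_pred (c i.+1)),
      set_of_pred (c 0%N) = P & set_of_pred (c n) = Q].
Proof.
elim: n P => [|n IH] P /=.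
  by move=> [pP <-]; have [p <-] := prime_of_set pP; exists (fun=> p).
move=> [r [pP Pr /IH[c [Hc c0 cn]]]]; have [p Ep] := prime_of_set pP.
exists (fun i => if i is j.+1 then c j else p); split=> // -[_|i /Hc//].
by rewrite Ep c0.
Qed.

Lemma strict_subP (p q : prime_idealr A) :
  strict_sub p q <-> set_of_pred p `<` set_of_pred q.
Proof. by []. Qed.

Lemma catenary_catenary_set : catenary A -> catenary_set A.
Proof.
move=> cA P Q pP pQ PQ; have [p Ep] := prime_of_set pP; have [q Eq] := prime_of_set pQ.
have [|[N bN] uniq] := cA p q; first by move=> x; move: (PQ x); rewrite -Ep -Eq.
split.
  exists N => n /seq_of_rchain[c [Hc c0 cn]]; apply: (bN n c); split.
  - by move=> i /Hc.
  - by apply/set_of_pred_eq; rewrite c0.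
  - by apply/set_of_pred_eq; rewrite cn.
have mx n : satchain n P Q -> exists c, maximal_chain_between p q n c.
  move=> /seq_of_rchain[c [Hc c0 cn]]; exists c; split; first split.
  - by move=> i /Hc[].
  - by apply/set_of_pred_eq; rewrite c0.
  - by apply/set_of_pred_eq; rewrite cn.
  move=> i /Hc[_ cov] [r [[h1 n1] [h2 n2]]].
  have [|||E|E] := cov (set_of_pred r) => //; first exact: set_of_prime.
    by apply: n1 => x; move/set_of_pred_eq: E => ->.
  by apply: n2 => x; move/set_of_pred_eq: E => ->.
by move=> n n' /mx[c Hc] /mx[c' Hc']; exact: uniq Hc Hc'.
Qed.
End Bridge.

(** * Catenarity of the iterated polynomial rings *)
Section MpolAlgebra.
Variable R : comNzRingType.

Fixpoint mpolC n : {rmorphism R -> mpol R n} :=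
  if n is k.+1 return {rmorphism R -> mpol R n}
  then (polyC \o mpolC k : {rmorphism R -> {poly mpol R k}})
  else (idfun : {rmorphism R -> R}).

Fixpoint mpol_vars n : seq (mpol R n) :=
  if n is k.+1 return seq (mpol R n)
  then ('X : {poly mpol R k}) :: map polyC (mpol_vars k) else [::].

Lemma mpol_gen n (S : set (mpol R n)) : (forall a, S (mpolC n a)) ->
  (forall x y, S x -> S y -> S (x + y)) -> (forall x y, S x -> S y -> S (x * y)) ->
  (forall x, x \in mpol_vars n -> S x) -> forall x, S x.
Proof.
elim: n S => [|n IH] S SC SD SM SX x; first exact: SC.
have SX' : S 'X by apply: SX; exact: mem_head.
have Sc c : S c%:P.
  move: c; apply: IH => [a|a b Sa Sb|a b Sa Sb|a aX].
  - exact: SC.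
  - by rewrite polyCD; exact: SD.
  - by rewrite polyCM; exact: SM.
  - by apply: SX; rewrite inE map_f ?orbT.
elim/poly_ind: (x : {poly mpol R n}) => [|p c Sp]; first exact: Sc.
by apply: SD => //; exact: SM.
Qed.

Lemma mpol_catenary n : universally_catenary R -> catenary_set (mpol R n).
Proof.
move=> uc; have /catenary_catenary_set : catenary (alg_of (mpolC n)).
  apply: (uc (alg_of (mpolC n) : comAlgType R)); exists (mpol_vars n).
  move=> S [S1 SZ SM] vS b.
  have S0 : 0 \in S.
    by have := SZ (-1) 1 1 S1 S1; rewrite scaleN1r addNr.
  apply: (@mpol_gen n [set x | (x : alg_of (mpolC n)) \in S]) => /=.
  - by move=> a; have := SZ a 1 0 S1 S0; rewrite addr0 => h; move: h; rewrite -[X in X \in S]/(_ * _) mulr1.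
  - by move=> x y Sx Sy; have := SZ 1 x y Sx Sy; rewrite scale1r.
  - by move=> x y; exact: SM.
  - by move=> x /vS.
have surj (b : mpol R n) : exists a, of_alg (f := mpolC n) a = b by exists b.
exact: catenary_set_surj surj.
Qed.
End MpolAlgebra.

(** * Laurent polynomials *)
Section Laurent.
Variable R : comNzRingType.

(** The ring R[t, 1/t] is R[u][t] / (u t - 1): here t is the outer variable and
    u the inner one. *)
Definition laurent_rel : {poly {poly R}} := 'X%:P * 'X - 1.

Definition laurent_ideal : pred {poly {poly R}} :=
  fun f => `[< exists h, f = h * laurent_rel >].

(** The leading coefficient u of u t - 1 is regular in R[u], so a nonzero
    multiple of u t - 1 has positive degree in t; hence R[u] embeds. *)
Lemma laurent_rel_const (h : {poly {poly R}}) c : h * laurent_rel = c%:P -> c = 0.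
Proof.
have [->|h0] := eqVneq h 0; first by rewrite mul0r => /esym/polyC_inj.
move=> E; have : (h * laurent_rel)`_(size h) = 0.
  by rewrite E coefC size_poly_eq0 (negPf h0).
rewrite /laurent_rel mulrBr mulr1 coefB [X in _ - X]nth_default // subr0.
rewrite mulrA coefMX size_poly_eq0 (negPf h0) coefMC -lead_coefE => /polyP H.
case/negP: h0; rewrite -lead_coef_eq0; apply/eqP/polyP => i.
by have := H i.+1; rewrite coefMX !coef0.
Qed.

Fact laurent_ideal_closed : idealr_closed laurent_ideal.
Proof.
split; first by apply/asboolP; exists 0; rewrite mul0r.
  apply/negP => /asboolP[h /esym/laurent_rel_const/eqP].
  by rewrite oner_eq0.
move=> a x y /asboolP[h ->] /asboolP[k ->]; apply/asboolP.
by exists (a * h + k); rewrite mulrDl mulrA.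
Qed.
HB.instance Definition _ := isIdealr.Build _ laurent_ideal laurent_ideal_closed.

Definition laurent_idealr : idealr {poly {poly R}} := laurent_ideal.

Definition laurent : comNzRingType := {ideal_quot laurent_idealr}.

Definition to_laurent : {rmorphism {poly R} -> laurent} :=
  (\pi_({ideal_quot laurent_idealr}) \o polyC)%FUN.
Definition laurent_t : laurent := \pi_({ideal_quot laurent_idealr}) 'X.
Definition laurent_u : laurent := to_laurent 'X.

Lemma laurent_piE f : (\pi_({ideal_quot laurent_idealr}) f == 0) = (f \in laurent_ideal).
Proof. by rewrite -[0](rmorph0 \pi_({ideal_quot laurent_idealr})) -Quotient.idealrBE subr0. Qed.

Lemma laurent_ut : laurent_u * laurent_t = 1.
Proof.
apply/eqP; rewrite -subr_eq0 /laurent_u /laurent_t /to_laurent /=.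
rewrite -rmorphM -[1](rmorph1 \pi_({ideal_quot laurent_idealr})) -rmorphB laurent_piE.
by apply/asboolP; exists 1; rewrite mul1r.
Qed.

Lemma laurent_unt n : laurent_u ^+ n * laurent_t ^+ n = 1.
Proof. by rewrite -exprMn laurent_ut expr1n. Qed.

Lemma to_laurent_inj : injective to_laurent.
Proof.
move=> f g /eqP; rewrite -subr_eq0 -rmorphB /to_laurent /= laurent_piE.
move=> /asboolP[h /esym/laurent_rel_const/eqP]; by rewrite subr_eq0 => /eqP.
Qed.

(** z is the fraction g(u) / u^n. *)
Definition rep (z : laurent) n (g : {poly R}) : Prop := laurent_u ^+ n * z = to_laurent g.

Lemma rep_shift z n g k : rep z n g -> rep z (n + k) (g * 'X^k).
Proof. by rewrite /rep addnC exprD -mulrA => ->; rewrite rmorphM rmorphXn mulrC. Qed.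

Lemma rep_inj z n g h : rep z n g -> rep z n h -> g = h.
Proof. by rewrite /rep => -> /to_laurent_inj. Qed.

Lemma rep_add z w n g h : rep z n g -> rep w n h -> rep (z + w) n (g + h).
Proof. by rewrite /rep mulrDr rmorphD => -> ->. Qed.

Lemma rep_opp z n g : rep z n g -> rep (- z) n (- g).
Proof. by rewrite /rep mulrN rmorphN => ->. Qed.

Lemma rep_mul z w n k g h : rep z n g -> rep w k h -> rep (z * w) (n + k) (g * h).
Proof. by rewrite /rep exprD mulrACA rmorphM => -> ->. Qed.

Lemma rep_val n g : rep (laurent_t ^+ n * to_laurent g) n g.
Proof. by rewrite /rep mulrA laurent_unt mul1r. Qed.

End Laurent.
Arguments to_laurent {R}.

(** * The extended Rees ring *)
Section PowerFacts.
Variables (R : comNzRingType) (m : idealr R).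

Lemma ideal_pow_le k n x : (k <= n)%N -> x \in ideal_pow m n -> x \in ideal_pow m k.
Proof.
move=> kn; rewrite -(subnK kn); elim: (n - k)%N x => // d IH x.
rewrite addSn => /ideal_powS[s [sP ->]]; apply: IH.
rewrite big_seq; apply: rpred_sum => ab /sP[_ h]; exact: ideal_powM.
Qed.

Lemma ideal_pow1E x : (x \in ideal_pow m 1) = (x \in m).
Proof.
apply/idP/idP; first exact: ideal_pow1.
move=> xm; apply/ideal_powS; exists [:: (x, 1)]; split; last by rewrite big_seq1 mulr1.
by move=> ab; rewrite inE => /eqP->; split=> //; exact: ideal_pow0E.
Qed.

(** The condition for g(u) / u^n to lie in R[m t, u]: the coefficient of X^i
    belongs to t^(n - i). For i > n the truncated difference is 0, and there is
    no condition, as required on negative powers of t. *)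
Definition pow_poly n (g : {poly R}) := forall i, g`_i \in ideal_pow m (n - i).

Lemma pow_poly_shift n g k : pow_poly n g -> pow_poly (n + k) (g * 'X^k).
Proof.
move=> H i; rewrite coefMXn; case: ltnP => [_|ki]; first exact: rpred0.
by have := H (i - k)%N; rewrite subnBA.
Qed.

Lemma pow_poly_unshift n g k : pow_poly (n + k) (g * 'X^k) -> pow_poly n g.
Proof.
move=> H i; have := H (i + k)%N; rewrite coefMXn ltnNge leq_addl /= addnK.
by rewrite subnDr.
Qed.

Lemma pow_poly_mul n g k h : pow_poly n g -> pow_poly k h -> pow_poly (n + k) (g * h).
Proof.
move=> Hg Hh i; rewrite coefM; apply: rpred_sum => j _.
apply: (@ideal_pow_le _ ((n - j) + (k - (i - j)))); last exact: ideal_pow_mul.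
have ji : (j <= i)%N by rewrite -ltnS.
rewrite -{1}(subnKC ji) leq_subLR addnACA.
by apply: leq_add; rewrite -leq_subLR.
Qed.

Definition in_rees : pred (laurent R) :=
  fun z => `[< exists n g, rep z n g /\ pow_poly n g >].

Lemma rep_lift (z : laurent R) n g k h : rep z n g -> rep z k h -> g * 'X^k = h * 'X^n.
Proof.
by move=> /rep_shift-/(_ k) E /rep_shift-/(_ n); rewrite addnC; exact: rep_inj.
Qed.

Lemma rep_pow (z : laurent R) n g k h : rep z n g -> rep z k h -> pow_poly n g -> pow_poly k h.
Proof.
move=> E E' /(@pow_poly_shift _ _ k); rewrite (rep_lift E E') addnC.
exact: pow_poly_unshift.
Qed.

Lemma in_reesP (z : laurent R) n g : rep z n g -> reflect (pow_poly n g) (z \in in_rees).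
Proof.
move=> E; apply: (iffP (asboolP _)) => [[k [h [E' H]]]|]; first exact: rep_pow E' E H.
by exists n, g.
Qed.

Lemma in_rees_rep z : z \in in_rees -> exists N, forall n, (N <= n)%N ->
  exists2 g, rep z n g & pow_poly n g.
Proof.
move=> /asboolP[N [g [E H]]]; exists N => n Nn; exists (g * 'X^(n - N)).
  by have := rep_shift (n - N) E; rewrite subnKC.
by have := pow_poly_shift (n - N) H; rewrite subnKC.
Qed.

Fact in_rees_closed : subring_closed in_rees.
Proof.
split.
- by apply/asboolP; exists 0%N, 1; split=> [|i]; [rewrite /rep mul1r rmorph1|exact: ideal_pow0E].
- move=> z w /in_rees_rep[N HN] /in_rees_rep[K HK].
  have [g Eg Hg] := HN _ (leq_addr K N); have [h Eh Hh] := HK _ (leq_addl N K).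
  apply/asboolP; exists (N + K)%N, (g - h); split; first exact: rep_add Eg (rep_opp Eh).
  by move=> i; rewrite coefB; exact: rpredB.
- move=> z w /asboolP[n [g [Eg Hg]]] /asboolP[k [h [Eh Hh]]].
  apply/asboolP; exists (n + k)%N, (g * h); split; first exact: rep_mul.
  exact: pow_poly_mul.
Qed.
HB.instance Definition _ := GRing.isSubringClosed.Build (laurent R) in_rees in_rees_closed.

(** The extended Rees ring R[m t, u] inside R[t, u]. *)
Record ext_rees : Type := ExtRees { rees_val :> laurent R; rees_mem : rees_val \in in_rees }.
HB.instance Definition _ := [isSub for rees_val].
HB.instance Definition _ := [Choice of ext_rees by <:].
HB.instance Definition _ := [SubChoice_isSubComNzRing of ext_rees by <:].

End PowerFacts.

Section ExtRees.
Variables (R : comNzRingType) (m : idealr R).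
Local Notation S := (ext_rees m).
Local Notation G := (assoc_graded m).
Implicit Types (z w s : S) (a b c : R) (g h : {poly R}).

Lemma rees_val_inj z w : rees_val z = rees_val w -> z = w. Proof. exact: val_inj. Qed.
(** These equations hold by conversion. They are stated for the projection
    rees_val itself because rewriting with the general morphism lemmas would
    leave its packed form. *)
Lemma rees_valD z w : rees_val (z + w) = rees_val z + rees_val w. Proof. by []. Qed.
Lemma rees_valB z w : rees_val (z - w) = rees_val z - rees_val w. Proof. by []. Qed.
Lemma rees_valM z w : rees_val (z * w) = rees_val z * rees_val w. Proof. by []. Qed.
Lemma rees_val1 : rees_val (1 : S) = 1. Proof. by []. Qed.
Lemma rees_val0 : rees_val (0 : S) = 0. Proof. by []. Qed.
Lemma rees_valX z n : rees_val (z ^+ n) = rees_val z ^+ n.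
Proof. by elim: n => // n IH; rewrite !exprS rees_valM IH. Qed.

Lemma rees_repP z : exists N, forall n, (N <= n)%N -> exists g, rep (rees_val z) n g.
Proof.
have [N H] := in_rees_rep (rees_mem z).
by exists N => n /H[g E _]; exists g.
Qed.

Lemma rees_rep z : exists n g, rep (rees_val z) n g.
Proof. by have [N H] := rees_repP z; exists N; exact: H. Qed.

Lemma rees_rep2 z w k : exists n g h, [/\ rep (rees_val z) n g, rep (rees_val w) n h & (k <= n)%N].
Proof.
have [[N HN] [K HK]] := (rees_repP z, rees_repP w).
exists (N + K + k)%N.
have [|g Eg] := HN (N + K + k)%N; first by rewrite -addnA leq_addr.
have [|h Eh] := HK (N + K + k)%N; first by rewrite addnAC leq_addl.
by exists g, h; rewrite leq_addl.
Qed.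

Lemma rees_pow z n g : rep (rees_val z) n g -> pow_poly m n g.
Proof. by move=> E; apply/(in_reesP m E)/rees_mem. Qed.

Definition rees_of n g (H : pow_poly m n g) : S :=
  @ExtRees R m (laurent_t R ^+ n * to_laurent g)
    (introT (in_reesP m (rep_val n g)) H).

Lemma rees_ofE n g (H : pow_poly m n g) : rep (rees_val (rees_of H)) n g.
Proof. exact: rep_val. Qed.

Lemma pow_poly0 g : pow_poly m 0 g.
Proof. by move=> i; rewrite sub0n ideal_pow0E. Qed.

Definition rees_poly g : S := rees_of (pow_poly0 g).
Lemma rees_polyE g : rees_val (rees_poly g) = to_laurent g.
Proof. by rewrite /= mul1r. Qed.

Fact rees_poly_zmod : zmod_morphism rees_poly.
Proof. by move=> g h; apply: rees_val_inj; rewrite rees_valB !rees_polyE rmorphB. Qed.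
Fact rees_poly_monoid : monoid_morphism rees_poly.
Proof.
split; first by apply: rees_val_inj; rewrite rees_polyE rees_val1 !rmorph1.
by move=> g h; apply: rees_val_inj; rewrite rees_valM !rees_polyE rmorphM.
Qed.
HB.instance Definition _ := GRing.isZmodMorphism.Build {poly R} S rees_poly rees_poly_zmod.
HB.instance Definition _ := GRing.isMonoidMorphism.Build {poly R} S rees_poly rees_poly_monoid.

Definition rees_u : S := rees_poly 'X.
Definition rees_const : {rmorphism R -> S} := (rees_poly \o polyC)%FUN.

Lemma rees_val_u : rees_val rees_u = laurent_u R. Proof. exact: rees_polyE. Qed.

Lemma rep_rees z n g : rep (rees_val z) n g <-> rees_u ^+ n * z = rees_poly g.
Proof.
rewrite /rep; split=> [E|/(congr1 (@rees_val R m))].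
  by apply: rees_val_inj; rewrite rees_valM rees_valX rees_polyE -E rees_val_u.
by rewrite rees_valM rees_valX rees_polyE rees_val_u.
Qed.

Lemma rees_u_regular z : rees_u * z = 0 -> z = 0.
Proof.
move=> /(congr1 (@rees_val R m)); rewrite rees_valM rees_val_u rees_val0 => E; apply: rees_val_inj.
by rewrite rees_val0 -[rees_val z]mul1r -(laurent_ut R) mulrAC E mul0r.
Qed.

Lemma pow_poly_const n c : c \in ideal_pow m n -> pow_poly m n c%:P.
Proof.
move=> H i; rewrite coefC; case: eqP => [->|_]; last exact: rpred0.
by rewrite subn0.
Qed.

(** The homogeneous element c t^n, for c in m^n. *)
Definition rees_hom n c (H : c \in ideal_pow m n) : S := rees_of (pow_poly_const H).

Lemma rees_homE n c (H : c \in ideal_pow m n) : rees_u ^+ n * rees_hom H = rees_const c.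
Proof. by apply/rep_rees/rees_ofE. Qed.

Lemma rees_uX_inj n z w : rees_u ^+ n * z = rees_u ^+ n * w -> z = w.
Proof.
elim: n => [|n IH]; first by rewrite !mul1r.
move=> E; apply: IH; apply/eqP; rewrite -subr_eq0; apply/eqP/rees_u_regular.
by rewrite mulrBr !mulrA -exprS E subrr.
Qed.

Lemma rees_homP n c (H : c \in ideal_pow m n) z :
  rees_u ^+ n * z = rees_const c -> rees_hom H = z.
Proof. by move=> E; apply: (@rees_uX_inj n); rewrite rees_homE. Qed.

Lemma rees_polyE_sum g :
  rees_poly g = \sum_(i < size g) rees_const g`_i * rees_u ^+ i.
Proof.
rewrite -[X in rees_poly X]coefK poly_def rmorph_sum; apply: eq_bigr => i _.
by rewrite -mul_polyC rmorphM rmorphXn.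
Qed.

(** The elements c t^n with c in m^n generate, and by induction on n they are
    sums of products of elements a t with a in m. *)
Lemma rees_gen (T : set S) (A : seq R) : (forall x, x \in m <-> span A x) ->
  (forall a, T (rees_const a)) -> T rees_u ->
  (forall a (H : a \in ideal_pow m 1), a \in A -> T (rees_hom H)) ->
  (forall z w, T z -> T w -> T (z + w)) -> (forall z w, T z -> T w -> T (z * w)) ->
  forall z, T z.
Proof.
move=> mA TC Tu TA TD TM z.
have T0 : T 0 by rewrite -(rmorph0 rees_const).
have TX w k : T w -> T (w ^+ k).
  by move=> Tw; elim: k => [|k IH]; [rewrite expr0 -(rmorph1 rees_const)|rewrite exprS; exact: TM].
have T1 c (H : c \in ideal_pow m 1) : T (rees_hom H).
  have : span A c by apply/mA; rewrite -ideal_pow1E.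
  have : {subset A <= A} by [].
  elim: {-2}A c H => [|a s IH] c H sA /=.
    by move=> c0; rewrite (@rees_homP _ _ _ (0)) // c0 rmorph0 mulr0.
  have aA : a \in A by apply: sA; exact: mem_head.
  have am : a \in ideal_pow m 1 by rewrite ideal_pow1E; apply/mA/mem_span.
  move=> [r _ h].
  have hm : c - a * r \in ideal_pow m 1.
    by rewrite ideal_pow1E; apply/mA; apply: span_subset h => x xs; apply: sA; rewrite inE xs orbT.
  rewrite (@rees_homP _ _ _ (rees_hom am * rees_const r + rees_hom hm)).
    apply: TD; first by apply: TM => //; exact: TA.
    by apply: IH => // x xs; apply: sA; rewrite inE xs orbT.
  by rewrite mulrDr mulrA !rees_homE -rmorphM -rmorphD addrC subrK.
have Tn n c (H : c \in ideal_pow m n) : T (rees_hom H).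
  elim: n c H => [|n IH] c H; first by rewrite (@rees_homP _ _ _ (rees_const c)) ?mul1r.
  have /ideal_powS[s [sP E]] := H; elim: s sP c H E => [|[a b] s IHs] sP c H E.
    by rewrite (@rees_homP _ _ _ (0)) // E big_nil rmorph0 mulr0.
  have [am bm] := sP _ (mem_head _ _); rewrite /= in am bm.
  have sP' ab : ab \in s -> ab.1 \in m /\ ab.2 \in ideal_pow m n.
    by move=> h; apply: sP; rewrite inE h orbT.
  have a1 : a \in ideal_pow m 1 by rewrite ideal_pow1E.
  pose d := \sum_(ab <- s) ab.1 * ab.2.
  have dm : d \in ideal_pow m n.+1 by apply/ideal_powS; exists s.
  rewrite (@rees_homP _ _ _ (rees_hom a1 * rees_hom bm + rees_hom dm)).
    by apply: TD; [apply: TM => //; exact: T1|exact: IHs].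
  have -> : rees_u ^+ n.+1 * (rees_hom a1 * rees_hom bm + rees_hom dm)
    = (rees_u ^+ 1 * rees_hom a1) * (rees_u ^+ n * rees_hom bm) + rees_u ^+ n.+1 * rees_hom dm.
    by rewrite mulrDr exprS expr1 mulrACA.
  by rewrite !rees_homE -rmorphM -rmorphD E big_cons.
have [n [g E]] := rees_rep z; have Hg := rees_pow E; move/rep_rees: E.
rewrite rees_polyE_sum => E.
have -> : z = \sum_(i < size g) rees_hom (Hg i) * rees_u ^+ (i - n).
  apply: (@rees_uX_inj n); rewrite E mulr_sumr; apply: eq_bigr => i _.
  rewrite -(rees_homE (Hg i)); set h := rees_hom _.
  have -> : rees_u ^+ (n - i) * h * rees_u ^+ i = rees_u ^+ (i + (n - i)) * h.
    by rewrite exprD mulrAC [_ ^+ i * _]mulrC.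
  have -> : rees_u ^+ n * (h * rees_u ^+ (i - n)) = rees_u ^+ (n + (i - n)) * h.
    by rewrite exprD mulrCA mulrC.
  by rewrite -!maxnE maxnC.
by elim/big_ind: _ => // i _; apply: TM => //; exact: TX.
Qed.

End ExtRees.

(** * The extended Rees ring modulo u *)
Section InitialForms.
Variables (R : comNzRingType) (m : idealr R).
Local Notation S := (ext_rees m).
Local Notation G := (assoc_graded m).
Implicit Types (z w s : S) (a b c : R) (g h : {poly R}).

(** The coefficient of t^k, for k >= 0. *)
Definition rees_coef z k : R :=
  let n := projT1 (cid (rees_rep z)) in
  let g := projT1 (cid (projT2 (cid (rees_rep z)))) in
  if (k <= n)%N then g`_(n - k) else 0.

Lemma rees_coefE z n g k : rep (rees_val z) n g ->
  rees_coef z k = if (k <= n)%N then g`_(n - k) else 0.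
Proof.
rewrite /rees_coef; case: (cid (rees_rep z)) => n' /= [g' E']; case: cid => {E'}g' E' /= E.
have H i : (g * 'X^n')`_i = (g' * 'X^n)`_i by rewrite (rep_lift E E').
have [kn|nk] := leqP k n; have [kn'|nk'] := leqP k n'; rewrite //.
- have := H (n + n' - k)%N; rewrite !coefMXn.
  rewrite !ifN -?leqNgt; [|lia|lia].
  by have [-> ->] : (n + n' - k - n' = n - k /\ n + n' - k - n = n' - k)%N by lia.
- have := H (n - k + n')%N; rewrite !coefMXn ltnNge leq_addl /= addnK => ->.
  by rewrite ifT //; lia.
- have := H (n' - k + n)%N; rewrite !coefMXn [in RHS]ltnNge leq_addl /= addnK => <-.
  by rewrite ifT //; lia.
Qed.

Lemma rees_coef_mem z k : rees_coef z k \in ideal_pow m k.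
Proof.
have [n [g E]] := rees_rep z; rewrite (rees_coefE k E); case: leqP => kn; last exact: rpred0.
by have := rees_pow E (n - k)%N; rewrite subKn.
Qed.

Lemma rees_coefB z w k : rees_coef (z - w) k = rees_coef z k - rees_coef w k.
Proof.
have [n [g [h [Eg Eh kn]]]] := rees_rep2 z w k.
have E : rep (rees_val (z - w)) n (g - h) by rewrite rees_valB; exact: rep_add Eg (rep_opp Eh).
by rewrite (rees_coefE k E) (rees_coefE k Eg) (rees_coefE k Eh) kn coefB.
Qed.

(** In the coefficient of t^k of a product, a factor of negative degree is
    matched by one of degree larger than k, whose coefficient is in m^(k+1). *)
Lemma rees_coefM z w k :
  rees_coef (z * w) k - conv (rees_coef z) (rees_coef w) k \in ideal_pow m k.+1.
Proof.
have [n [g [h [Eg Eh kn]]]] := rees_rep2 z w k.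
have E : rep (rees_val (z * w)) (n + n) (g * h) by exact: rep_mul.
have [Hg Hh] := (rees_pow Eg, rees_pow Eh).
rewrite convC (rees_coefE k E) ifT; last by lia.
rewrite coefM; set N := (n + n - k)%N.
rewrite -(big_mkord xpredT (fun i => g`_i * h`_(N - i))).
rewrite (@big_cat_nat _ _ _ (n - k)%N) //=; last by lia.
rewrite (@big_cat_nat _ _ _ n.+1 (n - k)%N) //=; [|by lia|by lia].
have -> : \sum_(n - k <= i < n.+1) g`_i * h`_(N - i) = conv (rees_coef w) (rees_coef z) k.
  rewrite -[X in \sum_(X <= _ < _) _]add0n big_addn (_ : n.+1 - (n - k) = k.+1)%N; last by lia.
  rewrite big_mkord; apply: eq_bigr => i _; have ik : (i <= k)%N by rewrite -ltnS.
  rewrite (rees_coefE i Eh) (rees_coefE _ Eg) !ifT; [|lia|lia].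
  by rewrite mulrC; congr (nth _ _ _ * nth _ _ _); rewrite /N; lia.
rewrite addrCA addrAC subrr add0r; apply: rpredD.
  rewrite big_seq_cond; apply: rpred_sum => i; rewrite mem_index_iota andbT => Hi.
  have := Hg i; move/(@ideal_pow_le _ _ k.+1) => H.
  by rewrite mulrC; apply: ideal_powM; apply: H; lia.
rewrite big_seq_cond; apply: rpred_sum => i; rewrite mem_index_iota andbT => Hi.
have := Hh (N - i)%N; move/(@ideal_pow_le _ _ k.+1) => H.
by apply: ideal_powM; apply: H; rewrite /N; lia.
Qed.

Fact rees_init_finite z : exists N, forall n, (N <= n)%N -> gr_class (rees_coef_mem z n) = 0.
Proof.
have [n [g E]] := rees_rep z; exists n.+1 => k nk; apply/eqP.
by rewrite gr_class0 (rees_coefE k E) leqNgt nk rpred0.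
Qed.

(** The surjection from the extended Rees ring to the associated graded ring,
    which takes coefficients of t^k modulo m^(k+1) and has kernel (u). *)
Definition rees_init z : G := AssocGraded (rees_init_finite z).

Lemma rees_init_lift z n : gr_lift (rees_init z) n - rees_coef z n \in ideal_pow m n.+1.
Proof. exact: (@gr_class_lift _ _ (rees_init z) n _ _ erefl). Qed.

Lemma pow_trans n (y x t : R) : x - y \in ideal_pow m n -> y - t \in ideal_pow m n ->
  x - t \in ideal_pow m n.
Proof. by move=> xy yz; rewrite -(subrK y x) -addrA rpredD. Qed.

Lemma pow_sym n (x y : R) : x - y \in ideal_pow m n -> y - x \in ideal_pow m n.
Proof. by rewrite -[y - x]opprB rpredN. Qed.

Lemma rees_initP f z : (forall n, gr_lift f n - rees_coef z n \in ideal_pow m n.+1) ->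
  f = rees_init z.
Proof.
move=> H; apply: gr_eqP => n; apply: pow_trans (H n) _.
exact/pow_sym/rees_init_lift.
Qed.

Fact rees_init_zmod : zmod_morphism rees_init.
Proof.
move=> z w; apply/esym/rees_initP => n.
have E : rees_init z = rees_init (z - w) + rees_init w.
  apply: esym; apply: rees_initP => k.
  apply: pow_trans (gr_lift_add _ _ _) _; rewrite -[X in _ - X](subrK (rees_coef w k)) -rees_coefB.
  by rewrite opprD addrACA; apply: rpredD; exact: rees_init_lift.
by rewrite E addrK; exact: rees_init_lift.
Qed.

Fact rees_init_monoid : monoid_morphism rees_init.
Proof.
split.
  apply/esym/rees_initP => n; apply: pow_trans (gr_lift_one _ _) _.
  (* 1 = u^n / u^n, so that the coefficient of t^n is read off at X^0 *)
  have E1 : rep (rees_val (1 : S)) n 'X^n by rewrite /rep rees_val1 mulr1 /laurent_u rmorphXn.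
  rewrite (rees_coefE n E1) leqnn subnn coefXn /gr_one_lift.
  by rewrite eq_sym subrr rpred0.
move=> z w; apply/esym/rees_initP => n; apply: pow_trans (gr_lift_mul _ _ _) _.
apply: pow_trans (pow_sym (rees_coefM z w n)).
apply: conv_congr => k; [exact: gr_lift_mem|exact: rees_coef_mem|exact: rees_init_lift..].
Qed.
HB.instance Definition _ := GRing.isZmodMorphism.Build S G rees_init rees_init_zmod.
HB.instance Definition _ := GRing.isMonoidMorphism.Build S G rees_init rees_init_monoid.

Lemma rees_init_surj (f : G) : exists z, rees_init z = f.
Proof.
have [N fN] := gr_finite f.
have H : pow_poly m N (\poly_(i < N.+1) gr_lift f (N - i)).
  move=> i; rewrite coef_poly; case: ltnP => _; last exact: rpred0.
  exact: gr_lift_mem.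
exists (rees_of H); apply/esym/rees_initP => k.
rewrite (rees_coefE k (rees_ofE H)); case: leqP => kN.
  by rewrite coef_poly ltnS leq_subr subKn // subrr rpred0.
by rewrite subr0; apply/gr_lift0/fN; exact: ltnW.
Qed.

Lemma rees_init0P z : rees_init z = 0 <-> forall k, rees_coef z k \in ideal_pow m k.+1.
Proof.
split=> [E k|H].
  rewrite -(gr_class0 (rees_coef_mem z k)); apply/eqP.
  by rewrite -[LHS]/(rees_init z k) E.
apply: gr_eq => n; apply/eqP.
by change (gr_class (rees_coef_mem z n) == 0); rewrite gr_class0.
Qed.

Lemma rees_init_u : rees_init (rees_u m) = 0.
Proof.
have E : rep (rees_val (rees_u m)) 0 'X by rewrite /rep mul1r rees_polyE.
apply/rees_init0P => k; rewrite (rees_coefE k E) leqn0; case: eqP => [->|_].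
  by rewrite coefX rpred0.
exact: rpred0.
Qed.

(** If all coefficients of g(u) / u^n gain one order of m, then g(u) / u^(n+1)
    is still in the extended Rees ring. *)
Lemma rees_init_ker z : rees_init z = 0 <-> exists w, z = rees_u m * w.
Proof.
split=> [/rees_init0P H|[w ->]]; last first.
  transitivity (rees_init (rees_u m) * rees_init w); first exact: (rmorphM rees_init).
  by rewrite rees_init_u mul0r.
have [n [g E]] := rees_rep z.
have Hg : pow_poly m n.+1 g.
  move=> i; have [ni|ni] := ltnP n i.
    by rewrite (_ : n.+1 - i = 0)%N ?ideal_pow0E //; lia.
  have := H (n - i)%N; rewrite (rees_coefE _ E) leq_subr subKn //.
  by rewrite (_ : (n - i).+1 = n.+1 - i)%N //; lia.
exists (rees_of Hg); apply: (@rees_uX_inj _ _ n).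
move/rep_rees: E => ->; rewrite mulrA -exprSr.
by apply/esym/rep_rees/rees_ofE.
Qed.

End InitialForms.

(** * The dimension inequality *)
Section PolyLength.
Variable A : comNzRingType.
Implicit Types X Y : set {poly A}.

(** One variable adds at most one to the length of the chains from X to Y, and
    nothing if X is not extended from A: all saturated chains from the
    extension of the contraction of X to Y have the same length, and one of
    them passes through X. *)
Lemma poly_chain_len X Y h : noeth {poly A} -> catenary_set {poly A} -> is_prime X -> is_prime Y ->
  X `<=` Y -> chain_len (poly_contr X) (poly_contr Y) h ->
  exists k, [/\ chain_len X Y k, (k <= h.+1)%N & poly_ext (poly_contr X) <> X -> (k <= h)%N].
Proof.
move=> nA cA pX pY XY [s _]; have [k0 k0h sk] := poly_satchain nA pY s.
have [_ bk] := satchain_len cA sk.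
have [k lk] := chain_len_exists cA pX pY XY; have [ck _] := lk.
have eX : poly_ext (poly_contr X) `<=` X by apply: poly_ext_gen => //; exact: prime_ideal.
have pe := poly_ext_prime (poly_contr_prime pX).
exists k; split=> //.
  have [k1 kk1 /bk] := chain_extend pe eX (satchain_chain ck).
  by move=> h1; rewrite (leq_trans kk1) // (leq_trans h1).
move=> ne; have : chain k.+1 (poly_ext (poly_contr X)) Y.
  by exists X; split=> //; [exact: proper_neq|exact: satchain_chain].
by move/bk => h1; rewrite -ltnS (leq_trans h1).
Qed.
End PolyLength.

Section Evaluation.
Variables (R B : comNzRingType) (f : {rmorphism R -> B}) (y : nat -> B).

Fixpoint mpol_eval n : {rmorphism mpol R n -> B} :=
  if n is k.+1 return {rmorphism mpol R n -> B}
  then (horner_morph (fun x => mulrC (y k) (mpol_eval k x)) : {rmorphism {poly mpol R k} -> B})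
  else f.

Lemma mpol_evalC n (c : mpol R n) : mpol_eval n.+1 c%:P = mpol_eval n c.
Proof. exact: horner_morphC. Qed.

Lemma mpol_evalX n : mpol_eval n.+1 ('X : {poly mpol R n}) = y n.
Proof. exact: horner_morphX. Qed.

Lemma mpol_eval_var n i : (i < n)%N -> exists c, mpol_eval n c = y i.
Proof.
elim: n => // n IH; rewrite ltnS leq_eqVlt => /orP[/eqP->|/IH[c <-]].
  by exists 'X; exact: mpol_evalX.
by exists c%:P; exact: mpol_evalC.
Qed.

Lemma mpol_eval_const n a : exists c, mpol_eval n c = f a.
Proof. by elim: n => [|n [c <-]]; [exists a|exists c%:P; exact: mpol_evalC]. Qed.

Hypotheses (nR : noeth R) (uc : universally_catenary R).
Variables P N : set B.
Hypotheses (pP : is_prime P) (pN : is_prime N) (PN : P `<=` N).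

Lemma poly_contr_eval n (Q : set B) :
  poly_contr ((mpol_eval n.+1 : {poly mpol R n} -> B) @^-1` Q) = mpol_eval n @^-1` Q.
Proof. by apply/seteqP; split=> x; rewrite /poly_contr /preimage /= mpol_evalC. Qed.

(** Evaluation at y_0, ..., y_n. The first variable adds at most one. The
    following ones are fractions b / c modulo P, so that the preimage of P
    contains c x - b and is not extended from one variable less. *)
Lemma eval_chain_len d : chain_len (f @^-1` P) (f @^-1` N) d ->
  (forall k, exists c b : mpol R k.+1,
     ~ P (mpol_eval k.+1 c) /\ mpol_eval k.+1 c * y k.+1 = mpol_eval k.+1 b) ->
  forall n, exists2 h, (h <= d.+1)%N & chain_len (mpol_eval n.+1 @^-1` P) (mpol_eval n.+1 @^-1` N) h.
Proof.
move=> ld frac.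
have step k h : chain_len (mpol_eval k @^-1` P) (mpol_eval k @^-1` N) h ->
  exists l, [/\ chain_len (mpol_eval k.+1 @^-1` P) (mpol_eval k.+1 @^-1` N) l, (l <= h.+1)%N &
    poly_ext (mpol_eval k @^-1` P) <> mpol_eval k.+1 @^-1` P -> (l <= h)%N].
  move=> lk.
  have := @poly_chain_len (mpol R k) (mpol_eval k.+1 @^-1` P) (mpol_eval k.+1 @^-1` N) h.
  rewrite !poly_contr_eval; apply=> //.
  - exact: (@mpol_noeth R k.+1 nR).
  - exact: (@mpol_catenary R k.+1 uc).
  - exact: (preim_prime (mpol_eval k.+1)).
  - exact: (preim_prime (mpol_eval k.+1)).
  - by move=> x; exact: PN.
elim=> [|n [h hd lh]]; first by have [h [lh hd _]] := step 0%N d ld; exists h.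
have [l [ll _ lh']] := step n.+1 h lh; exists l => //.
apply: leq_trans hd; apply: lh' => E.
have [c [b [nPc Ec]]] := frac n; apply: nPc.
have : (mpol_eval n.+2 @^-1` P) (c%:P * 'X - b%:P : {poly mpol R n.+1}).
  rewrite /preimage /= -[X in P X]/(mpol_eval n.+2 (c%:P * 'X - b%:P : {poly mpol R n.+1})).
  rewrite rmorphB rmorphM mpol_evalC mpol_evalX mpol_evalC Ec subrr.
  exact: id0 (prime_ideal pP).
rewrite -E => /(_ 1%N); rewrite /preimage /= coefB coefCM coefX eqxx mulr1 coefC /= subr0.
by [].
Qed.
End Evaluation.

(** * Extension of primes to the extended Rees ring *)
Section ReesPrimes.
Variables (R : comNzRingType) (m : idealr R).
Local Notation S := (ext_rees m).
Implicit Types (z w : S) (p : set R).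

Definition rees_ext p : set S :=
  [set z | exists n g, rep (rees_val z) n g /\ poly_ext p g].

Lemma poly_ext_mulXn p (g : {poly R}) n : is_ideal p -> poly_ext p (g * 'X^n) <-> poly_ext p g.
Proof.
move=> ip; split=> [H i|H]; last exact: idMr (poly_ext_ideal ip) H.
by have := H (i + n)%N; rewrite coefMXn ltnNge leq_addl /= addnK.
Qed.

Lemma rees_extE p z n g : is_ideal p -> rep (rees_val z) n g -> rees_ext p z <-> poly_ext p g.
Proof.
move=> ip E; split=> [[k [h [E' ph]]]|pg]; last by exists n, g.
by apply/(poly_ext_mulXn _ k ip); rewrite (rep_lift E E'); apply/poly_ext_mulXn.
Qed.

Lemma rees_ext_ideal p : is_ideal p -> is_ideal (rees_ext p).
Proof.
move=> ip; have ie := poly_ext_ideal ip; split.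
- exists 0%N, 0; split; last exact: id0 ie.
  by rewrite /rep rees_val0 mulr0 rmorph0.
- move=> z w zp wp; have [n [g [h [Eg Eh _]]]] := rees_rep2 z w 0.
  exists n, (g + h); split; first by rewrite rees_valD; exact: rep_add.
  by apply: (idD ie); [exact/(rees_extE ip Eg)|exact/(rees_extE ip Eh)].
- move=> w z [n [g [Eg pg]]]; have [k [h Eh]] := rees_rep w.
  exists (k + n)%N, (h * g); split; first by rewrite rees_valM; exact: rep_mul.
  exact: (idMl _ ie).
Qed.

Lemma rees_ext_const p a : is_ideal p -> rees_ext p (rees_const m a) <-> p a.
Proof.
move=> ip.
have E : rep (rees_val (rees_const m a)) 0 a%:P by rewrite /rep mul1r; exact: rees_polyE.
by rewrite (rees_extE ip E) poly_ext_const.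
Qed.

Lemma rees_ext_prime p : is_prime p -> is_prime (rees_ext p).
Proof.
move=> pp; have ip := prime_ideal pp; split; first exact: rees_ext_ideal.
  by rewrite -(rmorph1 (rees_const m)) => /(rees_ext_const _ ip)/(prime1 pp).
move=> z w; have [n [g Eg]] := rees_rep z; have [k [h Eh]] := rees_rep w.
have E : rep (rees_val (z * w)) (n + k) (g * h) by rewrite rees_valM; exact: rep_mul.
by rewrite (rees_extE ip Eg) (rees_extE ip Eh) (rees_extE ip E); exact: primeM (poly_ext_prime pp).
Qed.

Lemma rees_ext_u p : is_prime p -> ~ rees_ext p (rees_u m).
Proof.
move=> pp; have E : rep (rees_val (rees_u m)) 0 'X by rewrite /rep mul1r rees_polyE.
rewrite (rees_extE (prime_ideal pp) E) => /(_ 1%N); rewrite coefX; exact: prime1.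
Qed.

Lemma rees_ext_contr p : is_ideal p -> rees_const m @^-1` rees_ext p = p.
Proof. by move=> ip; apply/seteqP; split=> a /=; rewrite /preimage /= rees_ext_const. Qed.

Lemma rees_ext_sub p q : p `<=` q -> rees_ext p `<=` rees_ext q.
Proof. by move=> pq z [n [g [E pg]]]; exists n, g; split=> // i; exact: pq. Qed.

Lemma rees_ext_proper p q : is_ideal p -> is_ideal q -> p `<` q -> rees_ext p `<` rees_ext q.
Proof.
move=> ip iq [pq nqp]; split; first exact: rees_ext_sub.
by move=> H; apply: nqp => a qa; apply/(rees_ext_const _ ip)/H/rees_ext_const.
Qed.

Lemma rees_ext_chain n p q : chain n p q -> chain n (rees_ext p) (rees_ext q).
Proof.
elim: n p => [|n IH] p /=; first by move=> [pp <-]; split=> //; exact: rees_ext_prime.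
move=> [r [pp pr c]]; have [prr _] := rchain_prime c.
exists (rees_ext r); split; [exact: rees_ext_prime| |exact: IH].
exact: rees_ext_proper (prime_ideal pp) (prime_ideal prr) pr.
Qed.

(** If u^n z is a polynomial in u with coefficients in P, then z is in P. *)
Lemma rees_ext_least p (P : set S) : is_prime P -> ~ P (rees_u m) ->
  (forall a, p a -> P (rees_const m a)) -> rees_ext p `<=` P.
Proof.
move=> pP nPu pP' z [n [g [/rep_rees E pg]]].
apply: (prime_cancel pP (x := rees_u m ^+ n)); first by move/(prime_exp pP).
rewrite E rees_polyE_sum; apply: id_sum => [|i _]; first exact: prime_ideal.
by apply: idMr; [exact: prime_ideal|exact: pP'].
Qed.

End ReesPrimes.

(** * Associated primes modulo a regular element *)

(** Let H be the annihilator of the associated prime P. Then x H is the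
    intersection of H with (x), because x is regular. By Nakayama at Q, H is
    not contained in x H at Q; an element z of H that is not in x H at Q has
    an annihilator modulo x that contains P + (x) and is contained in Q. So Q
    is minimal over this annihilator, and thus associated to it. *)
Lemma regular_min_over_assoc (A : comNzRingType) (P Q : set A) (x y : A) : noeth A ->
  (forall z, x * z = 0 -> z = 0) -> (forall z, P z <-> z * y = 0) ->
  min_over (adjoin P x) Q ->
  exists w, forall a, Q a <-> exists b, a * w = x * b.
Proof.
move=> nA regx Py [pQ aQ mQ]; have iQ := prime_ideal pQ.
have iP : is_ideal P.
  split=> [|a b /Py Ea /Py Eb|a b /Py Eb]; apply/Py; first by rewrite mul0r.
    by rewrite mulrDl Ea Eb addr0.
  by rewrite -mulrA Eb mulr0.
pose H := [set h | forall a, P a -> a * h = 0].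
have iH : is_ideal H.
  split=> [a _|h k Hh Hk a Pa|c h Hh a Pa]; first by rewrite mulr0.
    by rewrite mulrDr Hh // Hk // addr0.
  by rewrite mulrCA Hh // mulr0.
have Hy : H y by move=> a /Py.
have Qx : Q x by apply: aQ; exact: adjoin_mem.
have PQ : P `<=` Q by apply: subset_trans aQ; exact: sub_adjoin.
(* z lies in H but not in x H at Q *)
have [z Hz nz] : exists2 z, H z & forall t, ~ Q t -> ~ exists2 h, H h & t * z = x * h.
  apply: contrapT => nz; have [s Es] := nA _ iH.
  have [||t nt Ht] := @nakayama _ Q [set 0] s pQ; first exact: ideal_zero.
    rewrite -Es => z Hz; apply: contrapT => nt; apply: nz; exists z => // t nQt [h Hh E].
    apply: nt; exists t => //; rewrite E -[x * h]addr0.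
    by apply: wspan_mul => //; [exact: ideal_zero|rewrite -Es].
  by apply/nt/PQ/Py; apply: Ht; rewrite -Es.
pose J := [set a | exists b, a * z = x * b].
have iJ : is_ideal J.
  split=> [|a b [c Ea] [d Eb]|a b [c Eb]].
  - by exists 0; rewrite mul0r mulr0.
  - by exists (c + d); rewrite mulrDl mulrDr Ea Eb.
  - by exists (a * c); rewrite -mulrA Eb mulrCA.
have JQ : J `<=` Q.
  move=> t [b E]; apply: contrapT => nt; apply: (nz t nt); exists b => // a Pa.
  by apply: regx; rewrite mulrCA -E mulrCA Hz // mulr0.
have aJ : adjoin P x `<=` J.
  apply: adjoin_sub => //; last by exists z.
  by move=> a Pa; exists 0; rewrite Hz // mulr0.
have [|w Hw] := @min_over_assoc _ nA J Q iJ.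
  by split=> // X pX JX; apply: mQ => //; exact: subset_trans JX.
exists (w * z) => a; rewrite Hw /J /=.
by split=> -[b E]; exists b; rewrite ?mulrA // -mulrA.
Qed.

(** * The extended Rees ring of a local ring *)
Section Local.
Variables (R : comNzRingType) (m : idealr R).
Hypotheses (nR : noeth R) (loc : local_ring m).
Local Notation mS := (set_of_pred m).

Lemma local_sub (I : set R) : is_ideal I -> ~ I 1 -> I `<=` mS.
Proof.
move=> iI I1; have [M [iM M1 IM maxM]] := ideal_in_maximal nR iI I1.
have [J EJ] := ideal_of_set iM M1; apply: subset_trans IM _.
rewrite -EJ => x; rewrite /set_of_pred /= (loc.2 J) // => K JK k kK.
suff E : set_of_pred K = M by have : set_of_pred K k by []; rewrite E -EJ.
apply: maxM; first exact: set_of_ideal.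
  by rewrite /set_of_pred /= idealr1.
by rewrite -EJ => z /JK.
Qed.

Lemma local_unit x : ~ mS x -> exists y, x * y = 1.
Proof.
move=> nx; have ia := adjoin_ideal x (ideal_zero R).
have [[r /eqP]|n1] := pselect (adjoin [set 0] x 1).
  by rewrite subr_eq0 => /eqP ->; exists r.
by case: nx; apply: (local_sub ia n1); exact: adjoin_mem (ideal_zero R).
Qed.

Lemma local_prime : is_prime mS.
Proof.
have im := set_of_ideal m; split=> //; first by rewrite /set_of_pred /= idealr1.
move=> x y mxy; have [|/local_unit[z E]] := pselect (mS x); first by left.
by right; rewrite -[y]mul1r -E mulrAC; exact: idMr.
Qed.

Lemma prime_sub_local P : is_prime P -> P `<=` mS.
Proof. by move=> pP; apply: local_sub; [exact: prime_ideal|exact: prime1]. Qed.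

Local Notation S := (ext_rees m).
Local Notation G := (assoc_graded m).

(** The maximal ideal of the elements whose constant coefficient is in m; its
    image in the associated graded ring is the ideal of positive degrees. *)
Definition graded_maximal : set S := [set z | rees_coef z 0 \in m].

Lemma rees_coef0M (z w : S) : rees_coef (z * w) 0 - rees_coef z 0 * rees_coef w 0 \in m.
Proof.
by have := rees_coefM z w 0; rewrite /conv big_ord1 ideal_pow1E.
Qed.

Lemma graded_maximal_prime : is_prime graded_maximal.
Proof.
have im := set_of_ideal m; have pm := local_prime.
have c0 k : rees_coef (0 : S) k = 0 by rewrite -(subrr (0 : S)) rees_coefB subrr.
have E (z w : S) : mS (rees_coef (z * w) 0) <-> mS (rees_coef z 0 * rees_coef w 0).
  split=> h; last exact: (@id_subl _ mS _ _ im (rees_coef0M z w) h).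
  rewrite -[X in mS X](subKr (rees_coef (z * w) 0)).
  by apply: idB => //; exact: rees_coef0M.
split; first split.
- by rewrite /graded_maximal /= c0 rpred0.
- move=> z w hz hw; rewrite /graded_maximal /= -[w]opprK -[- w]add0r !rees_coefB c0.
  by rewrite sub0r opprK rpredD.
- by move=> w z hz; apply/(E w z); exact: (idMl _ im).
- have E1 : rep (rees_val (1 : S)) 0 1 by rewrite /rep mul1r rmorph1.
  by rewrite /graded_maximal /= (rees_coefE 0 E1) coef1 idealr1.
- by move=> z w /E/(primeM pm).
Qed.

Lemma graded_maximal_u : graded_maximal (rees_u m).
Proof.
have /rees_init0P/(_ 0%N) := rees_init_u m; by rewrite ideal_pow1E.
Qed.

Lemma rees_ext_graded_maximal p : is_prime p -> rees_ext p `<` graded_maximal.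
Proof.
move=> pp; split; last by move=> /(_ _ graded_maximal_u)/rees_ext_u-/(_ pp).
move=> z [n [g [E pg]]]; rewrite /graded_maximal /= (rees_coefE 0 E) leq0n.
exact: prime_sub_local pp _ (pg _).
Qed.

(** Look at the lowest degree in which s does not vanish modulo u. *)
Lemma unit_coef_regular (z s : S) : ~ graded_maximal z ->
  rees_init (z * s) = 0 -> rees_init s = 0.
Proof.
move=> nz /rees_init0P H; apply/rees_init0P => k0; apply: contrapT => nk0.
have [k nk mk] := @ex_min nat id (fun k => ~ rees_coef s k \in ideal_pow m k.+1) k0 nk0.
have [v Ev] := local_unit nz; apply: nk.
have low i : (i < k)%N -> rees_coef s i \in ideal_pow m i.+1.
  by move=> ik; apply: contrapT => /mk; rewrite leqNgt ik.
have : conv (rees_coef z) (rees_coef s) k \in ideal_pow m k.+1.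
  by rewrite -[conv _ _ k](subKr (rees_coef (z * s) k)); apply: rpredB => //; exact: rees_coefM.
rewrite /conv big_ord_recl subn0 => h.
have h2 : rees_coef z 0 * rees_coef s k \in ideal_pow m k.+1.
  rewrite -[X in X \in _](addrK (\sum_(i < k) rees_coef z (lift ord0 i) * rees_coef s (k - lift ord0 i)%N)).
  apply: rpredB => //; apply: rpred_sum => i _; rewrite lift0.
  apply: (@ideal_pow_mul_eq _ _ i.+1 (k - i.+1).+1); first by have := ltn_ord i; lia.
    exact: rees_coef_mem.
  by apply: low; have := ltn_ord i; lia.
have -> : rees_coef s k = v * (rees_coef z 0 * rees_coef s k) by rewrite mulrA [v * _]mulrC Ev mul1r.
exact: ideal_powM.
Qed.

(** An element of Q outside this ideal would be regular modulo u, but elements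
    of a minimal prime are zero divisors. *)
Lemma min_over_graded_maximal Q : noeth S -> min_over [set z : S | rees_init z = 0] Q ->
  Q `<=` graded_maximal.
Proof.
move=> nS mQ z Qz; apply: contrapT => nz.
have iK : is_ideal [set z : S | rees_init z = 0].
  exact: (@preim_ideal _ _ (rees_init (m := m)) _ (ideal_zero _)).
have [n [t [nt E]]] := min_over_nilp nS iK mQ Qz.
have [_ KQ _] := mQ; apply/nt/KQ.
elim: n E => [|n IH]; first by rewrite mul1r.
rewrite exprS -mulrA => E; apply: IH; exact: unit_coef_regular nz E.
Qed.

End Local.

(** * Comparison of the chains of R and of its associated graded ring *)

(** The integers n for which this holds are the lengths of chains of primes of
    A/P. *)
Definition chain_above (A : comNzRingType) (P : set A) n : Prop :=
  exists r q, P `<=` r /\ chain n r q.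

Section Comparison.
Variables (R : comNzRingType) (m : idealr R).
Hypotheses (nR : noeth R) (loc : local_ring m) (uc : universally_catenary R).
Local Notation mS := (set_of_pred m).
Local Notation S := (ext_rees m).
Local Notation G := (assoc_graded m).
Local Notation u := (rees_u m).
Local Notation init := (rees_init (m := m)).
Local Notation Mgr := (@graded_maximal R m).

(** The points y_1, ..., y_n are the fractions a/u = a t with a running over
    generators of m; the following y_k only need to be fractions too. *)
Lemma rees_evaluation : exists (y : nat -> S) n,
  [/\ y 0%N = u, forall b : S, exists a, mpol_eval (rees_const m) y n.+1 a = b &
      forall k, exists a, u * y k.+1 = rees_const m a].
Proof.
have [A EA] := nR (set_of_ideal m).
have memA i : A`_i \in ideal_pow m 1.
  rewrite ideal_pow1E; have [ia|ai] := ltnP i (size A); last by rewrite nth_default ?rpred0.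
  have : set_of_pred m A`_i by rewrite EA; apply: mem_span; exact: mem_nth.
  by [].
pose y i : S := if i is j.+1 then rees_hom (memA j) else u.
exists y, (size A); split=> // [|k]; last by exists A`_k; rewrite -(rees_homE (memA k)) expr1.
apply: (@rees_gen _ _ _ A).
- by move=> x; have <- : mS x = span A x by rewrite EA.
- exact: mpol_eval_const.
- exact: (@mpol_eval_var R S (rees_const m) y (size A).+1 0%N isT).
- move=> a H aA; have ia : (index a A < size A)%N by rewrite index_mem.
  have -> : rees_hom H = y (index a A).+1.
    by apply: rees_homP; rewrite rees_homE nth_index.
  exact: (@mpol_eval_var R S (rees_const m) y (size A).+1 (index a A).+1).
- by move=> _ _ [a <-] [b <-]; exists (a + b); rewrite rmorphD.
- by move=> _ _ [a <-] [b <-]; exists (a * b); rewrite rmorphM.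
Qed.

Lemma rees_noeth : noeth S.
Proof.
have [y [n [_ surj _]]] := rees_evaluation.
exact: noeth_surj surj (@mpol_noeth R n.+1 nR).
Qed.

Lemma rees_catenary : catenary_set S.
Proof.
have [y [n [_ surj _]]] := rees_evaluation.
exact: catenary_set_surj surj (@mpol_catenary R n.+1 uc).
Qed.

Lemma graded_noeth : noeth G.
Proof. exact: noeth_surj (@rees_init_surj _ m) rees_noeth. Qed.

Definition init_ker : set S := [set z | rees_init z = 0].

Lemma init_ker_sub (Q : set S) : is_ideal Q -> Q u -> init_ker `<=` Q.
Proof. by move=> iQ Qu z /rees_init_ker[w ->]; exact: idMr. Qed.

Lemma init_ker_u : init_ker u. Proof. exact: rees_init_u. Qed.

Lemma preim_min_over (P : set G) : min_over [set 0] P -> min_over init_ker (init @^-1` P).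
Proof.
move=> [pP _ mP]; have iP := prime_ideal pP.
split; first exact: (preim_prime (rees_init (m := m))).
  by move=> z; rewrite /init_ker /preimage /= => ->; exact: id0.
move=> X pX kX XP; have iX := prime_ideal pX.
have E := @preim_image _ _ (rees_init (m := m)) X iX kX.
rewrite -E; congr (_ @^-1` _); apply: mP.
- exact: (@image_prime _ _ (rees_init (m := m)) (@rees_init_surj _ m)).
- by move=> _ ->; exists 0; [exact: id0|exact: (rmorph0 (rees_init (m := m)))].
- by move=> _ [x /XP h <-].
Qed.

(** The prime X below avoids all u^k s with s outside Q; it lies below Q and
    does not contain u, so Q contains the extension of its contraction to R. *)
Lemma graded_chain_lower_bound (P : set G) : min_over [set 0] P ->
  exists2 p : set R, min_over [set 0] p & forall n, chain_above p n -> chain_above P n.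
Proof.
move=> minP; have minQ := preim_min_over minP.
set Q := init @^-1` P in minQ; have [pQ kQ mQ] := minQ.
have Qu : Q u by apply: kQ; exact: init_ker_u.
have [||||X [pX _ XT]] := @prime_avoiding _ rees_noeth
    [set z | exists k s, ~ Q s /\ z = u ^+ k * s] [set 0].
- by exists 0%N, 1; rewrite mulr1; split=> //; exact: prime1.
- move=> _ _ [k [s [ns ->]]] [l [t [nt ->]]]; exists (k + l)%N, (s * t).
  by split; [exact: primeNM|rewrite exprD mulrACA].
- exact: ideal_zero.
- move=> _ -> [k [s [ns E]]]; apply: ns; rewrite (_ : s = 0); first exact: id0 (prime_ideal pQ).
  by apply: (@rees_uX_inj _ _ k); rewrite mulr0.
have XQ : X `<=` Q.
  by move=> z Xz; apply: contrapT => nz; apply: (XT z Xz); exists 0%N, z; rewrite mul1r.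
have nXu : ~ X u.
  by move=> /XT; apply; exists 1%N, 1; split; [exact: prime1|rewrite expr1 mulr1].
have pX' := preim_prime (rees_const m) pX.
have [|p minp pX1] := @min_over_exists _ [set 0] _ pX'.
  by move=> _ ->; exact: id0 (prime_ideal pX').
exists p => //; have [pp _ _] := minp; have pP0 := rees_ext_prime m pp.
have P0Q : rees_ext p `<=` Q by apply: subset_trans XQ; exact: rees_ext_least.
have nu := @rees_ext_u _ m _ pp.
have cov : covers (rees_ext p) Q.
  split; first by split=> // /(_ u Qu).
  move=> q pq pq' qQ; apply: (krull_principal_ideal rees_noeth (x := u)) => //.
  split=> //; first by apply: adjoin_sub => //; exact: prime_ideal.
  move=> Y pY aY; apply: mQ => //; apply: init_ker_sub; first exact: prime_ideal.
  by apply: aY; apply: adjoin_mem; exact: prime_ideal.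
have pM := graded_maximal_prime nR loc.
have QM : Q `<=` Mgr by exact: (min_over_graded_maximal nR loc rees_noeth minQ).
move=> n [r [q [pr c]]]; have [_ pq] := rchain_prime c.
(* the extra step: u is in M but in no extended prime *)
have c1 : chain 1 (rees_ext q) Mgr.
  exists Mgr; split=> //; first exact: rees_ext_prime.
  exact: (rees_ext_graded_maximal nR loc).
have [k nk ck] := chain_extend pP0 (rees_ext_sub pr) (rchain_concat (rees_ext_chain m c) c1).
case: k nk ck => [|k]; first by rewrite addn1.
rewrite addn1 ltnS => nk ck.
have [r' Qr cr] := chain_over_cover rees_catenary cov pP0 pQ pM QM ck.
have [r2 rr2 cr2] := chain_drop nk cr.
have kr2 z : rees_init z = 0 -> r2 z by move=> /kQ/Qr/rr2.
exists (init @` r2), (init @` Mgr); split.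
  move=> b; have [z <-] := rees_init_surj b => Pz; exists z => //.
  by apply/rr2/Qr.
exact: (@image_chain _ _ (rees_init (m := m)) (@rees_init_surj _ m)).
Qed.

Lemma min_prime_assoc (A : comNzRingType) (P : set A) : noeth A -> min_over [set 0] P ->
  exists w, forall a, P a <-> a * w = 0.
Proof. by move=> nA /(min_over_assoc nA (ideal_zero A)). Qed.

Lemma assoc_set (A : comNzRingType) (p : prime_idealr A) w :
  (forall a, set_of_pred p a <-> a * w = 0) -> associated_prime p.
Proof. by move=> H; exists w => a; exact: H. Qed.

(** A minimal prime below P is associated, so P would be embedded if it were
    not minimal. *)
Lemma S1_assoc_min (A : comNzRingType) (P : set A) w : noeth A -> serre_S1 A ->
  is_prime P -> (forall a, P a <-> a * w = 0) -> min_over [set 0] P.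
Proof.
move=> nA S1 pP Pw; have iP := prime_ideal pP.
have P0 : [set 0] `<=` P by move=> _ ->; exact: id0.
split=> // X pX X0 XP.
have [Y minY YX] := min_over_exists pX X0; have [pY _ _] := minY.
have [v Yv] := min_prime_assoc nA minY.
apply/seteqP; split=> //; apply: (subset_trans _ YX).
apply: contrapT => nPY; apply: S1.
have [p Ep] := prime_of_set pP; have [q Eq] := prime_of_set pY.
exists p; split; first by apply: (@assoc_set _ _ w); rewrite Ep.
exists q; split; first by apply: (@assoc_set _ _ v); rewrite Eq.
apply/strict_subP; rewrite Ep Eq; split; last by move=> h; apply: nPY.
exact: subset_trans YX XP.
Qed.

Lemma graded_chain_upper_bound (p : set R) : serre_S1 G -> min_over [set 0] p ->
  exists2 P : set G, min_over [set 0] P & forall n, chain_above P n -> chain_above p n.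
Proof.
move=> S1 minp; have [pp _ _] := minp; have [c pc] := min_prime_assoc nR minp.
have pP0 := rees_ext_prime m pp; have iP0 := prime_ideal pP0.
have P0c (z : S) : rees_ext p z <-> z * rees_const m c = 0.
  have [n [g E]] := rees_rep z; rewrite (rees_extE (prime_ideal pp) E).
  have E' : rep (rees_val (z * rees_const m c)) n (g * c%:P).
    by apply/rep_rees; rewrite mulrA; move/rep_rees: E => ->; rewrite rmorphM.
  split=> [H|Z].
    have Z : g * c%:P = 0 by apply/polyP => i; rewrite coefMC coef0; apply/pc.
    by apply: (@rees_uX_inj _ _ n); move/rep_rees: E' => ->; rewrite Z mulr0 rmorph0.
  have Zg : g * c%:P = 0.
    apply: to_laurent_inj; rewrite rmorph0 -E' Z; exact: mulr0.
  by move=> i; apply/pc; rewrite -coefMC Zg coef0.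
have pM := graded_maximal_prime nR loc; have [P0M _] := rees_ext_graded_maximal nR loc pp.
have [|Q minQ QM] := @min_over_exists _ (adjoin (rees_ext p) u) _ pM.
  by apply: adjoin_sub => //; [exact: prime_ideal|exact: graded_maximal_u].
have [pQ aQ _] := minQ; have iQ := prime_ideal pQ.
have Qu : Q u by apply: aQ; exact: adjoin_mem.
have P0Q : rees_ext p `<=` Q by apply: subset_trans aQ; exact: sub_adjoin.
have kQ := init_ker_sub iQ Qu.
have [w Qw] := regular_min_over_assoc rees_noeth (@rees_u_regular _ m) P0c minQ.
have EQ := @preim_image _ _ (rees_init (m := m)) Q iQ kQ.
have pP := @image_prime _ _ (rees_init (m := m)) (@rees_init_surj _ m) Q pQ kQ.
exists (init @` Q).
  apply: (@S1_assoc_min _ _ (init w) graded_noeth S1 pP) => b.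
  have [a <-] := rees_init_surj b.
  have -> : (init @` Q) (init a) <-> Q a by rewrite -{2}EQ.
  rewrite Qw -rees_init_ker; have -> // : rees_init (a * w) = rees_init a * rees_init w.
  exact: (rmorphM (rees_init (m := m))).
have pm := local_prime nR loc.
have [d ld] := chain_len_exists (@mpol_catenary R 0 uc) pp pm (prime_sub_local nR loc pp).
have [cd _] := ld.
move=> n [r [q [Pr cr]]].
set r' : set S := init @^-1` r; set N : set S := init @^-1` q.
have cN : chain n r' N := preim_chain (@rees_init_surj _ m) cr.
have [pr' pN] := rchain_prime cN; have iN := prime_ideal pN.
have Qr' : Q `<=` r' by move=> z Qz; apply: Pr; exists z.
have r'N := chain_sub cN; have P0r' := subset_trans P0Q Qr'.
have c1 : chain n.+1 (rees_ext p) N.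
  exists r'; split=> //; split=> // /(_ u (Qr' _ Qu)); exact: rees_ext_u.
have Nu : N u by apply/r'N/Qr'.
(* u is in N, and a = u (a/u) for a in m *)
have EN : rees_const m @^-1` N = mS.
  apply/seteqP; split; first exact: prime_sub_local (preim_prime (rees_const m) pN).
  move=> a am; have a1 : a \in ideal_pow m 1 by rewrite ideal_pow1E.
  have Ea : rees_const m a = u * rees_hom a1 by rewrite -(rees_homE a1) expr1.
  by change (N (rees_const m a)); rewrite Ea; exact: idMr.
have [y [k [y0 surj frac]]] := rees_evaluation.
have [||h hd [_ bh]] := @eval_chain_len R S (rees_const m) y nR uc _ _ pP0 pN (subset_trans P0r' r'N) d _ _ k.
- by rewrite EN rees_ext_contr //; exact: prime_ideal.
- move=> i; have [c1' Ec1] := @mpol_eval_var R S (rees_const m) y i.+1 0%N isT.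
  have [a Ea] := frac i; have [b Eb] := mpol_eval_const (rees_const m) y i.+1 a.
  by exists c1', b; rewrite Ec1 y0 Eb Ea; split=> //; exact: rees_ext_u.
have nd : (n <= d)%N by rewrite -ltnS (leq_trans (bh _ (preim_chain surj c1))).
have [r0 pr0 c0] := chain_drop nd (satchain_chain cd).
by exists r0, mS.
Qed.

End Comparison.

(** * Krull dimension and subdimension *)
Section Dimension.
Local Open Scope ereal_scope.

(** The possible Krull dimensions of a nonzero ring. They are well-ordered,
    which is what makes the minimum in the definition of sdim exist. *)
Definition dim_value (e : \bar int) : Prop := e = +oo \/ exists n : nat, e = (n%:Z)%:E.

Definition sup_dim (D : set nat) : \bar int := supremum -oo [set (n%:Z)%:E | n in D].

Lemma sup_dim_isLub (D : set nat) : D 0%N ->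
  dim_value (sup_dim D) /\ supremums [set (n%:Z)%:E | n in D] (sup_dim D).
Proof.
move=> D0; set E := [set _ | _ in _].
have nE : E == set0 = false by apply/negbTE/set0P; exists (0%:Z)%:E; exists 0%N.
have [e [de Ee]] : exists e, dim_value e /\ supremums E e.
  have [[N bN]|unb] := pselect (exists N, forall n, D n -> (n <= N)%N).
    have exD : exists n, `[< D n >] by exists 0%N; apply/asboolP.
    have bD n : `[< D n >] -> (n <= N)%N by move/asboolP/bN.
    have [n /asboolP Dn max] := ex_maxnP exD bD.
    exists (n%:Z)%:E; split; first by right; exists n.
    split; last by move=> e; apply; exists n.
    by move=> _ [k Dk <-]; rewrite lee_fin lez_nat; apply: max; apply/asboolP.
  exists +oo; split; first by left.
  split; first by move=> e _; exact: leey.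
  move=> [z| |] ub; [exfalso|by []|].
    apply: unb; exists `|z|%N => n Dn; have : (n%:Z)%:E <= z%:E by apply: ub; exists n.
    by rewrite lee_fin; lia.
  by have : (0%:Z)%:E <= -oo :> \bar int by apply: ub; exists 0%N.
have -> : sup_dim D = e.
  rewrite /sup_dim /supremum -/E nE.
  have := @xgetPex _ -oo (supremums E) (ex_intro _ e Ee).
  set x := xget _ _ => -[ubx lbx]; case: Ee => ube lbe.
  by apply/eqP; rewrite eq_le; apply/andP; split; [exact: lbx|exact: lbe].
by [].
Qed.

Lemma sup_dim_le (D E : set nat) : D 0%N -> E 0%N -> D `<=` E -> sup_dim D <= sup_dim E.
Proof.
move=> D0 E0 DE; have [_ [_ lb]] := sup_dim_isLub D0; have [_ [ub _]] := sup_dim_isLub E0.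
by apply: lb => _ [n Dn <-]; apply: ub; exists n => //; exact: DE.
Qed.

Lemma minimum_in (K : set (\bar int)) : K `<=` dim_value -> K !=set0 ->
  K (minimum K) /\ lbound K (minimum K).
Proof.
move=> Kd [e0 Ke0]; suff [e He] : exists e, (K `&` lbound K) e.
  exact: (@xgetPex _ +oo (K `&` lbound K) (ex_intro _ e He)).
have [[n0 Kn0]|nfin] := pselect (exists n : nat, K (n%:Z)%:E).
  have [n Kn mn] := @ex_min nat id (fun n : nat => K (n%:Z)%:E) n0 Kn0.
  exists (n%:Z)%:E; split=> // e Ke; have [->|[k E]] := Kd e Ke; first exact: leey.
  by rewrite E lee_fin lez_nat; apply: mn; rewrite -E.
exists +oo; split.
  by have [<-//|[k E]] := Kd _ Ke0; case: nfin; exists k; rewrite -E.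
by move=> e Ke; have [->//|[k E]] := Kd _ Ke; case: nfin; exists k; rewrite -E.
Qed.

End Dimension.

Lemma krull_dim_quot (A : comNzRingType) (p : prime_idealr A) :
  krull_dim {ideal_quot (p : idealr A)} = sup_dim [set n | chain_above (set_of_pred p) n].
Proof.
rewrite /krull_dim /sup_dim; congr (supremum _ [set _ | n in _]).
pose f : {rmorphism A -> {ideal_quot (p : idealr A)}} := \pi_({ideal_quot (p : idealr A)}).
have surj b : exists a, f a = b by exists (repr b); exact: reprK.
have kerf a : f a = 0 <-> set_of_pred p a.
  have E : (a \in p) = (f a == 0).
    by rewrite -[in LHS](subr0 a) Quotient.idealrBE -[in RHS](rmorph0 f).
  by rewrite /set_of_pred /= E; split=> /eqP.
apply/seteqP; split=> n.
  move=> [c Hc]; have cc := rchain_of_seq (rel := @classical_sets.proper _) (c := c) (n := n) Hc.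
  have := preim_chain surj cc; exists (f @^-1` set_of_pred (c 0%N)), (f @^-1` set_of_pred (c n)).
  split=> // a /kerf fa; rewrite /preimage /= fa; exact: (rpred0 (c 0%N)).
move=> [r [q [pr c]]].
have [|c' [Hc' _ _]] := seq_of_rchain (@image_chain _ _ f surj n r q _ c); last by exists c'.
by move=> x /kerf/pr.
Qed.

Lemma chain_above0 (A : comNzRingType) (P : set A) : is_prime P -> chain_above P 0.
Proof. by move=> pP; exists P, P; split. Qed.

Lemma minimal_primeP (A : comNzRingType) (p : prime_idealr A) :
  minimal_prime p <-> min_over [set 0] (set_of_pred p).
Proof.
have pp := set_of_prime p; split=> [H|[_ _ mp] q qp].
  split=> // [_ ->|P pP _ Pp]; first exact: id0 (prime_ideal pp).
  have [q Eq] := prime_of_set pP; apply/seteqP; split=> //.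
  by rewrite -Eq; apply: H; move: Pp; rewrite -Eq.
have E : set_of_pred q = set_of_pred p.
  apply: mp => //; first exact: set_of_prime.
  by move=> _ ->; exact: id0 (prime_ideal (set_of_prime q)).
by move=> x px; have : set_of_pred q x by rewrite E.
Qed.

Lemma sdim_le (A B : comNzRingType) :
  (exists P : set A, is_prime P) -> (exists P : set B, is_prime P) ->
  (forall P : set B, min_over [set 0] P ->
    exists2 p : set A, min_over [set 0] p & forall n, chain_above p n -> chain_above P n) ->
  (sdim A <= sdim B)%E.
Proof.
move=> [X pX] [Y pY] H.
pose K (C : comNzRingType) := [set krull_dim {ideal_quot (p : idealr C)} | p in @minimal_prime C].
have Kd C : K C `<=` dim_value.
  move=> _ [p _ <-]; rewrite krull_dim_quot.
  by have [] := @sup_dim_isLub _ (chain_above0 (set_of_prime p)).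
have Kne (C : comNzRingType) (Z : set C) : is_prime Z -> K C !=set0.
  move=> pZ; have [|P mP _] := @min_over_exists C [set 0] Z pZ.
    by move=> _ ->; exact: id0 (prime_ideal pZ).
  have [pP _ _] := mP; have [p Ep] := prime_of_set pP.
  by exists (krull_dim {ideal_quot (p : idealr C)}); exists p => //; apply/minimal_primeP; rewrite Ep.
have [_ lbA] := minimum_in (Kd A) (Kne A X pX).
have [[P mP EP] _] := minimum_in (Kd B) (Kne B Y pY).
have -> : sdim B = krull_dim {ideal_quot (P : idealr B)} by exact: esym EP.
have [p minp Hp] := H _ (proj1 (minimal_primeP P) mP).
have [pp _ _] := minp; have [p' Ep'] := prime_of_set pp.
apply: (@le_trans _ _ (krull_dim {ideal_quot (p' : idealr A)})).
  by apply: lbA; exists p' => //; apply/minimal_primeP; rewrite Ep'.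
rewrite !krull_dim_quot; apply: sup_dim_le; [exact: chain_above0 (set_of_prime _)..|].
by rewrite Ep'.
Qed.

Theorem theorem4p7 (R : comNzRingType) (m : idealr R)
  (R_noetherian : noetherian R) (R_local : local_ring m)
  (R_ucat : universally_catenary R) :
  (sdim R <= sdim (assoc_graded m))%E /\
  (serre_S1 (assoc_graded m) -> sdim (assoc_graded m) = sdim R).
Proof.
have nR := noetherian_noeth R_noetherian.
have nG : noeth (assoc_graded m) by exact: graded_noeth.
have exR : exists P : set R, is_prime P by exists (set_of_pred m); exact: local_prime.
have exG : exists P : set (assoc_graded m), is_prime P.
  have [//||||P [pP _ _]] := @prime_avoiding _ nG [set 1] [set 0]; last by exists P.
  - by move=> _ _ -> ->; rewrite mulr1.
  - exact: ideal_zero.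
  - by move=> _ -> /esym/eqP; rewrite oner_eq0.
have le : (sdim R <= sdim (assoc_graded m))%E.
  by apply: sdim_le => // P; exact: graded_chain_lower_bound.
split=> // S1; apply/eqP; rewrite eq_le le andbT.
by apply: sdim_le => // p; exact: graded_chain_upper_bound.
Qed.
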